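(* Let $\mathcal{I}$ be a small category and let $\mathfrak{B}=(\mathcal{C},F,U)$ be an $\mathcal{I}$-indexed adjunction bundle of model categories. Assume that $\mathbf{Tw}(\mathcal{I},\mathfrak{B})$ carries a model structure with pointwise weak equivalences and that $\hbar\colon \mathrm{Ho}\,\mathbf{Tw}(\mathcal{I},\mathfrak{B})\to \mathbf{Tw}(\mathcal{I},\mathrm{Ho}_{\mathrm f}\,\mathfrak{B})$ is a functor obtained by one of the three constructions (Case 1, Case 2, Case 3) described in the context. Then an object $Y\in \mathbf{Tw}(\mathcal{I},\mathfrak{B})$ is a left homotopy sheaf if and only if $\hbar(Y)\in\mathbf{Tw}(\mathcal{I},\mathrm{Ho}_{\mathrm f}\,\mathfrak{B})$ is a left strict sheaf. In particular, if $Y\to Z$ is a weak equivalence of twisted diagrams in $\mathbf{Tw}(\mathcal{I},\mathfrak{B})$, then $Y$ is a left homotopy sheaf if and only if $Z$ is a left homotopy sheaf.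
   Context: **Adjunction bundles.** Let $\mathcal{I}$ be a small category. An adjunction bundle $\mathfrak{B}=(\mathcal{C},F,U)$ over $\mathcal{I}$ consists of a category $\mathcal{C}_i$ for each object $i$ and, for each morphism $\sigma\colon i\to j$, an adjoint pair $F_\sigma\colon\mathcal{C}_i\to\mathcal{C}_j$ (left adjoint), $U_\sigma\colon\mathcal{C}_j\to\mathcal{C}_i$ (right adjoint), such that $U_{\mathrm{id}_i}=\mathrm{id}=F_{\mathrm{id}_i}$ and $U_{\tau\circ\sigma}=U_\sigma\circ U_\tau$ for composable $\sigma,\tau$. **Twisted diagrams.** A twisted diagram $Y$ with coefficients in $\mathfrak{B}$ consists of objects $Y_i\in\mathcal{C}_i$ and maps $y_\sigma^\flat\colon Y_i\to U_\sigma(Y_j)$ for $\sigma\colon i\to j$ with $y^\flat_{\mathrm{id}_i}=\mathrm{id}$ and $y^\flat_{\tau\circ\sigma}=U_\sigma(y^\flat_\tau)\circ y^\flat_\sigma$. Its adjoint is denoted $y^\sharp_\sigma\colon F_\sigma(Y_i)\to Y_j$. A map $f\colon Y\to Z$ is a family $f_i\colon Y_i\to Z_i$ with $U_\sigma(f_j)\circ y^\flat_\sigma=z^\flat_\sigma\circ f_i$ for all $\sigma\colon i\to j$. The resulting category is $\mathbf{Tw}(\mathcal{I},\mathfrak{B})$. **Model categories.** A model category is understood in the sense of Dwyer–Spalinski (finite limits and colimits exist; factorisations exist but need not be functorial). $\mathfrak{B}$ is an adjunction bundle of model categories if every $\mathcal{C}_i$ is a model category and every $F_\sigma$ preserves cofibrations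 and acyclic cofibrations (so $(F_\sigma,U_\sigma)$ is a Quillen pair). A map $f$ of twisted diagrams is a (pointwise) weak equivalence if every $f_i$ is a weak equivalence in $\mathcal{C}_i$. **Associated homotopy bundle.** For a model category $\mathcal{C}$, let $\mathcal{C}^f$ be its full subcategory of fibrant objects, $\mathrm{Ho}\,\mathcal{C}$ its homotopy category (same objects as $\mathcal{C}$), and $\mathrm{Ho}_{\mathrm f}\,\mathcal{C}$ the full subcategory of $\mathrm{Ho}\,\mathcal{C}$ generated by the fibrant objects; the restriction $\gamma_f\colon\mathcal{C}^f\to\mathrm{Ho}_{\mathrm f}\,\mathcal{C}$ of the localisation functor is the localisation of $\mathcal{C}^f$ at the weak equivalences. Choose for each object $X$ a cofibrant replacement $p_X\colon X^c\to X$ (an acyclic fibration with $X^c$ cofibrant, the identity if $X$ is cofibrant) and a fibrant replacement $q_X\colon X\to X^f$ (an acyclic cofibration with $X^f$ fibrant, the identity if $X$ is fibrant). For a right Quillen functor $U\colon\mathcal{C}\to\mathcal{D}$ with left adjoint $F$, $\mathbf{R}_fU\colon\mathrm{Ho}_{\mathrm f}\,\mathcal{C}\to\mathrm{Ho}_{\mathrm f}\,\mathcal{D}$ is the functor induced by $U$, i.e. the functor with $\mathbf{R}_fU\circ\gamma_f=\gamma_f\circ U$ on $\mathcal{C}^f$ (thus $\mathbf{R}_fU(X)=U(X)$ on objects); it has a left adjoint $\mathbf{L}_fF$, given on objects by $\mathbf{L}_fF(X)=F(X^c)^f$ (with $\mathbf{L}_f\mathrm{id}$ taken to be $\mathrm{id}$).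 One has $\mathbf{R}_f\mathrm{id}=\mathrm{id}$ and $\mathbf{R}_f(V\circ U)=\mathbf{R}_fV\circ\mathbf{R}_fU$. The associated homotopy bundle $\mathrm{Ho}_{\mathrm f}\,\mathfrak{B}$ is the $\mathcal{I}$-indexed adjunction bundle with categories $\mathrm{Ho}_{\mathrm f}\,\mathcal{C}_i$ and adjoint pairs $(\mathbf{L}_fF_\sigma,\mathbf{R}_fU_\sigma)$. **Construction of $\hbar$.** If $Y\in\mathbf{Tw}(\mathcal{I},\mathfrak{B})$ is pointwise fibrant (all $Y_i$ fibrant), let $\Gamma(Y)\in\mathbf{Tw}(\mathcal{I},\mathrm{Ho}_{\mathrm f}\,\mathfrak{B})$ be the twisted diagram with components $\gamma_f(Y_i)=Y_i$ and $\flat$-type structure maps $\gamma_f(y^\flat_\sigma)\colon Y_i\to U_\sigma(Y_j)=\mathbf{R}_fU_\sigma(\gamma_f(Y_j))$; a map $f$ of pointwise fibrant twisted diagrams induces $\Gamma(f)$ with components $\gamma_f(f_i)$. Assume $\mathbf{Tw}(\mathcal{I},\mathfrak{B})$ is equipped with a model structure with pointwise weak equivalences. - *Case 1:* all objects of all $\mathcal{C}_i$ are fibrant. Then $\hbar$ is the functor induced on $\mathrm{Ho}\,\mathbf{Tw}(\mathcal{I},\mathfrak{B})$ by $Y\mapsto\Gamma(Y)$. - *Case 2:* fibrant objects of $\mathbf{Tw}(\mathcal{I},\mathfrak{B})$ are pointwise fibrant, and $\mathbf{Tw}(\mathcal{I},\mathfrak{B})$ has a fibrant replacement functor $Y\mapsto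 Y^f$. Then $\hbar$ is the functor induced on $\mathrm{Ho}\,\mathbf{Tw}(\mathcal{I},\mathfrak{B})$ by $Y\mapsto\Gamma(Y^f)$. - *Case 3:* fibrant objects of $\mathbf{Tw}(\mathcal{I},\mathfrak{B})$ are pointwise fibrant. Let $\mathfrak{K}$ be the category of fibrant and cofibrant twisted diagrams with homotopy classes of maps as morphisms, $\nu\colon\mathfrak{K}\to\mathrm{Ho}\,\mathbf{Tw}(\mathcal{I},\mathfrak{B})$ the inclusion (an equivalence), and $\phi\colon\mathfrak{K}\to\mathbf{Tw}(\mathcal{I},\mathrm{Ho}_{\mathrm f}\,\mathfrak{B})$ the functor $Y\mapsto\Gamma(Y)$, $[\bar f]\mapsto\Gamma(\bar f)$. Then $\hbar$ is the composition of an inverse (up to natural isomorphism) of $\nu$ with $\phi$. For $Y\in\mathbf{Tw}(\mathcal{I},\mathfrak{B})$, $\hbar(Y)$ means $\hbar$ applied to the image of $Y$ in $\mathrm{Ho}\,\mathbf{Tw}(\mathcal{I},\mathfrak{B})$. **Sheaves.** For any adjunction bundle, a twisted diagram $Y$ is a left strict sheaf if $y_\sigma^\sharp\colon F_\sigma(Y_i)\to Y_j$ is an isomorphism for all morphisms $\sigma\colon i\to j$ of $\mathcal{I}$. For an adjunction bundle of model categories, $Y$ is a left homotopy sheaf if for every morphism $\sigma\colon i\to j$ of $\mathcal{I}$ there is an acyclic fibration $\bar Y_i\to Y_i$ in $\mathcal{C}_i$ with $\bar Y_i$ cofibrant such that the adjoint $F_\sigma(\bar Y_i)\to Y_j$ of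 the composite $\bar Y_i\to Y_i\xrightarrow{y^\flat_\sigma}U_\sigma(Y_j)$ is a weak equivalence in $\mathcal{C}_j$. *)

(* Defs.v *)
(* Categories have Leibniz equality on morphisms; classical choice and
   extensionality are used only to form quotient types and to identify records
   up to their proof components. *)
From Stdlib Require Import ssreflect.
From Stdlib Require Import List FinFun Relations.
From Stdlib Require Import ProofIrrelevance FunctionalExtensionality
  PropExtensionality ClassicalEpsilon.

Set Implicit Arguments.
Unset Strict Implicit.
Unset Printing Implicit Defensive.
#[local] Obligation Tactic := idtac.

Declare Scope cat_scope.
Delimit Scope cat_scope with cat.
Open Scope cat_scope.

Record Category := {
  Ob :> Type;
  Hom : Ob -> Ob -> Type;
  idm : forall x, Hom x x;
  comp : forall x y z, Hom y z -> Hom x y -> Hom x z;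
  comp_idl : forall x y (f : Hom x y), comp (idm y) f = f;
  comp_idr : forall x y (f : Hom x y), comp f (idm x) = f;
  comp_assoc : forall x y z t (h : Hom z t) (g : Hom y z) (f : Hom x y),
    comp h (comp g f) = comp (comp h g) f }.

Arguments idm {c} _.
Arguments comp {c x y z} _ _.
Notation "g ∘ f" := (comp g f) (at level 40, left associativity) : cat_scope.

Definition is_iso (C : Category) (x y : C) (f : Hom x y) : Prop :=
  exists g : Hom y x, g ∘ f = idm x /\ f ∘ g = idm y.

(* An equality of objects, viewed as a morphism; used to state identities
   between morphisms whose (co)domains agree only up to a proved equality. *)
Definition eq_hom (C : Category) (x y : C) (e : x = y) : Hom x y :=
  match e in _ = y return Hom x y with eq_refl => idm x end.

Record Functor (C D : Category) := {
  fob :> C -> D;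
  fmap : forall x y, Hom x y -> Hom (fob x) (fob y);
  fmap_id : forall x, fmap (idm x) = idm (fob x);
  fmap_comp : forall x y z (g : Hom y z) (f : Hom x y),
    fmap (g ∘ f) = fmap g ∘ fmap f }.

Arguments fmap {C D} _ {x y} _.

Definition Idf (C : Category) : Functor C C :=
  {| fob := fun x => x; fmap := fun x y f => f;
     fmap_id := fun x => eq_refl; fmap_comp := fun x y z g f => eq_refl |}.

Program Definition fcomp (C D E : Category) (G : Functor D E) (F : Functor C D)
  : Functor C E :=
  {| fob := fun x => G (F x); fmap := fun x y f => fmap G (fmap F f) |}.
Next Obligation. by move=> * /=; rewrite !fmap_id. Qed.
Next Obligation. by move=> * /=; rewrite !fmap_comp. Qed.

Notation "G ⊚ F" := (fcomp G F) (at level 40, left associativity) : cat_scope.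

Inductive is_identity_functor : forall C D : Category, Functor C D -> Prop :=
| identity_functor C : is_identity_functor (Idf C).

Definition functor_eq_ob (C D : Category) (F G : Functor C D) (e : F = G)
  (x : C) : F x = G x := f_equal (fun K : Functor C D => K x) e.

Definition nat_isomorphic (C D : Category) (F G : Functor C D) : Prop :=
  exists eta : forall x, Hom (F x) (G x),
    (forall x y (f : Hom x y), eta y ∘ fmap F f = fmap G f ∘ eta x) /\
    (forall x, is_iso (eta x)).

Record Adjunction (C D : Category) (F : Functor C D) (U : Functor D C) := {
  flat_of : forall x y, Hom (F x) y -> Hom x (U y);
  sharp_of : forall x y, Hom x (U y) -> Hom (F x) y;
  sharp_flat : forall x y (f : Hom (F x) y), sharp_of (flat_of f) = f;
  flat_sharp : forall x y (g : Hom x (U y)), flat_of (sharp_of g) = g;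
  flat_natl : forall x x' y (f : Hom (F x) y) (h : Hom x' x),
    flat_of (f ∘ fmap F h) = flat_of f ∘ h;
  flat_natr : forall x y y' (f : Hom (F x) y) (k : Hom y y'),
    flat_of (k ∘ f) = fmap U k ∘ flat_of f }.

Arguments flat_of {C D F U} _ {x y} _.
Arguments sharp_of {C D F U} _ {x y} _.

Definition FullSub (C : Category) (P : C -> Prop) : Category :=
  {| Ob := {x : C | P x};
     Hom := fun x y => Hom (proj1_sig x) (proj1_sig y);
     idm := fun x => idm (proj1_sig x);
     comp := fun x y z g f => g ∘ f;
     comp_idl := fun x y f => comp_idl f;
     comp_idr := fun x y f => comp_idr f;
     comp_assoc := fun x y z t h g f => comp_assoc h g f |}.

Definition full_incl (C : Category) (P : C -> Prop) : Functor (FullSub P) C :=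
  {| fob := fun x : FullSub P => proj1_sig x; fmap := fun x y f => f;
     fmap_id := fun x => eq_refl; fmap_comp := fun x y z g f => eq_refl |}.

Definition full_lift (C D : Category) (P : D -> Prop) (F : Functor C D)
  (hF : forall x, P (F x)) : Functor C (FullSub P) :=
  {| fob := fun x => exist P (F x) (hF x) : FullSub P;
     fmap := fun x y f => fmap F f;
     fmap_id := fun x => fmap_id F x;
     fmap_comp := fun x y z g f => fmap_comp F g f |}.

Definition full_restr (C D : Category) (P : C -> Prop) (Q : D -> Prop)
  (F : Functor C D) (hF : forall x, P x -> Q (F x))
  : Functor (FullSub P) (FullSub Q) :=
  @full_lift (FullSub P) D Q (F ⊚ full_incl P)
    (fun x => hF (proj1_sig x) (proj2_sig x)).

Definition finite_category (D : Category) : Prop :=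
  Finite D /\ forall x y : D, Finite (Hom x y).

Definition is_limit (D C : Category) (G : Functor D C) (L : C)
  (p : forall d, Hom L (G d)) : Prop :=
  (forall d d' (u : Hom d d'), fmap G u ∘ p d = p d') /\
  (forall (X : C) (q : forall d, Hom X (G d)),
     (forall d d' (u : Hom d d'), fmap G u ∘ q d = q d') ->
     exists! h : Hom X L, forall d, p d ∘ h = q d).

Definition is_colimit (D C : Category) (G : Functor D C) (L : C)
  (p : forall d, Hom (G d) L) : Prop :=
  (forall d d' (u : Hom d d'), p d' ∘ fmap G u = p d) /\
  (forall (X : C) (q : forall d, Hom (G d) X),
     (forall d d' (u : Hom d d'), q d' ∘ fmap G u = q d) ->
     exists! h : Hom L X, forall d, h ∘ p d = q d).

Definition terminal (C : Category) (T : C) : Prop :=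
  forall X : C, exists! f : Hom X T, True.

Definition initial (C : Category) (T : C) : Prop :=
  forall X : C, exists! f : Hom T X, True.

Definition morphism_class (C : Category) := forall x y : C, Hom x y -> Prop.

Definition retract_of (C : Category) (x x' y y' : C)
  (f : Hom x x') (g : Hom y y') : Prop :=
  exists (i : Hom x y) (r : Hom y x) (i' : Hom x' y') (r' : Hom y' x'),
    r ∘ i = idm x /\ r' ∘ i' = idm x' /\
    g ∘ i = i' ∘ f /\ f ∘ r = r' ∘ g.

Definition has_lifting (C : Category) (a b x y : C)
  (i : Hom a b) (p : Hom x y) : Prop :=
  forall (u : Hom a x) (v : Hom b y), p ∘ u = v ∘ i ->
    exists h : Hom b x, h ∘ i = u /\ p ∘ h = v.

(* Model structures in the sense of Dwyer-Spalinski: only finite limits and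
   colimits are required, and factorisations need not be functorial. *)
Record ModelStructure (C : Category) := {
  weq : morphism_class C;
  cof : morphism_class C;
  fib : morphism_class C;
  weq_id : forall x, weq (idm x);
  cof_id : forall x, cof (idm x);
  fib_id : forall x, fib (idm x);
  weq_comp : forall x y z (g : Hom y z) (f : Hom x y),
    weq g -> weq f -> weq (g ∘ f);
  cof_comp : forall x y z (g : Hom y z) (f : Hom x y),
    cof g -> cof f -> cof (g ∘ f);
  fib_comp : forall x y z (g : Hom y z) (f : Hom x y),
    fib g -> fib f -> fib (g ∘ f);
  finite_limits : forall (D : Category) (G : Functor D C),
    finite_category D -> exists L p, @is_limit D C G L p;
  finite_colimits : forall (D : Category) (G : Functor D C),
    finite_category D -> exists L p, @is_colimit D C G L p;
  weq_cancel_l : forall x y z (g : Hom y z) (f : Hom x y),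
    weq g -> weq (g ∘ f) -> weq f;
  weq_cancel_r : forall x y z (g : Hom y z) (f : Hom x y),
    weq f -> weq (g ∘ f) -> weq g;
  weq_retract : forall x x' y y' (f : Hom x x') (g : Hom y y'),
    retract_of f g -> weq g -> weq f;
  cof_retract : forall x x' y y' (f : Hom x x') (g : Hom y y'),
    retract_of f g -> cof g -> cof f;
  fib_retract : forall x x' y y' (f : Hom x x') (g : Hom y y'),
    retract_of f g -> fib g -> fib f;
  lift_cof_acfib : forall a b x y (i : Hom a b) (p : Hom x y),
    cof i -> fib p -> weq p -> has_lifting i p;
  lift_accof_fib : forall a b x y (i : Hom a b) (p : Hom x y),
    cof i -> weq i -> fib p -> has_lifting i p;
  factor_cof_acfib : forall x y (f : Hom x y),
    exists z (i : Hom x z) (p : Hom z y),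
      f = p ∘ i /\ cof i /\ fib p /\ weq p;
  factor_accof_fib : forall x y (f : Hom x y),
    exists z (i : Hom x z) (p : Hom z y),
      f = p ∘ i /\ cof i /\ weq i /\ fib p }.

Arguments weq {C} _ {x y} _.
Arguments cof {C} _ {x y} _.
Arguments fib {C} _ {x y} _.

Definition fibrant (C : Category) (M : ModelStructure C) (X : C) : Prop :=
  exists (T : C) (t : Hom X T), terminal T /\ fib M t.

Definition cofibrant (C : Category) (M : ModelStructure C) (X : C) : Prop :=
  exists (T : C) (t : Hom T X), initial T /\ cof M t.

Definition acyclic_fib (C : Category) (M : ModelStructure C) (x y : C)
  (p : Hom x y) : Prop := fib M p /\ weq M p.

Definition acyclic_cof (C : Category) (M : ModelStructure C) (x y : C)
  (i : Hom x y) : Prop := cof M i /\ weq M i.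

Record Replacements (C : Category) (M : ModelStructure C) := {
  cof_repl : C -> C;
  cof_repl_map : forall X, Hom (cof_repl X) X;
  cof_repl_cofibrant : forall X, cofibrant M (cof_repl X);
  cof_repl_acfib : forall X, acyclic_fib M (cof_repl_map X);
  cof_repl_id : forall X, cofibrant M X ->
    exists e : cof_repl X = X, cof_repl_map X = eq_hom e;
  fib_repl : C -> C;
  fib_repl_map : forall X, Hom X (fib_repl X);
  fib_repl_fibrant : forall X, fibrant M (fib_repl X);
  fib_repl_accof : forall X, acyclic_cof M (fib_repl_map X);
  fib_repl_id : forall X, fibrant M X ->
    exists e : X = fib_repl X, fib_repl_map X = eq_hom e }.

Section Quotient.
Variables (A : Type) (R : relation A).

Definition quot : Type := {P : A -> Prop | exists a, P = R a}.
Definition class (a : A) : quot :=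
  exist _ (R a) (ex_intro (fun a' => R a = R a') a eq_refl).
Definition repr (q : quot) : A :=
  proj1_sig (constructive_indefinite_description _ (proj2_sig q)).

Lemma class_repr q : class (repr q) = q.
Proof.
rewrite /repr; case: constructive_indefinite_description => a /= e.
by case: q e => P hP /= e; subst P; apply: subset_eq_compat.
Qed.

Lemma class_eq : equivalence A R -> forall a b, R a b -> class a = class b.
Proof.
move=> [_ tR sR] a b ab; apply: subset_eq_compat.
apply: functional_extensionality => c; apply: propositional_extensionality.
by split=> h; [apply: tR (sR _ _ ab) h | apply: tR ab h].
Qed.

Lemma class_inj : equivalence A R -> forall a b, class a = class b -> R a b.
Proof.
move=> [rR _ _] a b /(f_equal (@proj1_sig _ _)) /= e.
by rewrite e; apply: rR.
Qed.

Lemma repr_class : equivalence A R -> forall a, R (repr (class a)) a.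
Proof. by move=> eR a; apply: class_inj => //; rewrite class_repr. Qed.

End Quotient.

(* The localisation C[W^-1] (universal property: loc_universal), with the same
   objects as C.  Morphisms are formal composites of morphisms of C and formal
   inverses of morphisms in W, modulo the congruence generated by the axioms of
   a category, the functoriality of lm_of and the inverse laws. *)
Section Localisation.
Variables (C : Category) (W : morphism_class C).

Inductive lmor : C -> C -> Type :=
| lm_of x y (f : Hom x y) : lmor x y
| lm_inv x y (w : Hom x y) (hw : W w) : lmor y x
| lm_comp x y z (q : lmor y z) (p : lmor x y) : lmor x z.

Inductive lmor_eq : forall x y, relation (lmor x y) :=
| lme_refl x y (p : lmor x y) : lmor_eq p p
| lme_sym x y (p q : lmor x y) : lmor_eq p q -> lmor_eq q p
| lme_trans x y (p q r : lmor x y) :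
    lmor_eq p q -> lmor_eq q r -> lmor_eq p r
| lme_cong x y z (q q' : lmor y z) (p p' : lmor x y) :
    lmor_eq q q' -> lmor_eq p p' -> lmor_eq (lm_comp q p) (lm_comp q' p')
| lme_idl x y (p : lmor x y) : lmor_eq (lm_comp (lm_of (idm y)) p) p
| lme_idr x y (p : lmor x y) : lmor_eq (lm_comp p (lm_of (idm x))) p
| lme_assoc x y z t (r : lmor z t) (q : lmor y z) (p : lmor x y) :
    lmor_eq (lm_comp r (lm_comp q p)) (lm_comp (lm_comp r q) p)
| lme_of_comp x y z (g : Hom y z) (f : Hom x y) :
    lmor_eq (lm_of (g ∘ f)) (lm_comp (lm_of g) (lm_of f))
| lme_invl x y (w : Hom x y) (hw : W w) :
    lmor_eq (lm_comp (lm_inv hw) (lm_of w)) (lm_of (idm x))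
| lme_invr x y (w : Hom x y) (hw : W w) :
    lmor_eq (lm_comp (lm_of w) (lm_inv hw)) (lm_of (idm y)).

Lemma lmor_equiv x y : equivalence (lmor x y) (@lmor_eq x y).
Proof.
by split=> [p|p q r|p q]; [apply: lme_refl|apply: lme_trans|apply: lme_sym].
Qed.

Lemma lcomp_class x y z (q : lmor y z) (p : lmor x y) :
  class (@lmor_eq x z)
    (lm_comp (repr (class (@lmor_eq y z) q)) (repr (class (@lmor_eq x y) p)))
  = class (@lmor_eq x z) (lm_comp q p).
Proof.
apply: class_eq; first exact: lmor_equiv.
by apply: lme_cong; apply: repr_class; apply: lmor_equiv.
Qed.

Program Definition Loc : Category :=
  {| Ob := C;
     Hom := fun x y => quot (@lmor_eq x y);
     idm := fun x => class (@lmor_eq x x) (lm_of (idm x));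
     comp := fun x y z q p => class (@lmor_eq x z) (lm_comp (repr q) (repr p)) |}.
Next Obligation.
move=> x y f; rewrite -[in LHS](class_repr f) lcomp_class -[RHS]class_repr.
by apply: class_eq; [apply: lmor_equiv|apply: lme_idl].
Qed.
Next Obligation.
move=> x y f; rewrite -[in LHS](class_repr f) lcomp_class -[RHS]class_repr.
by apply: class_eq; [apply: lmor_equiv|apply: lme_idr].
Qed.
Next Obligation.
move=> x y z t h g f /=.
rewrite -(class_repr h) -(class_repr g) -(class_repr f) !lcomp_class !class_repr.
by apply: class_eq; [apply: lmor_equiv|apply: lme_assoc].
Qed.

Program Definition loc_functor : Functor C Loc :=
  {| fob := fun x => x : Loc;
     fmap := fun x y f => class (@lmor_eq x y) (lm_of f) |}.
Next Obligation. by []. Qed.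
Next Obligation.
move=> x y z g f /=; rewrite lcomp_class.
by apply: class_eq; [apply: lmor_equiv|apply: lme_of_comp].
Qed.

Lemma loc_inverts x y (w : Hom x y) : W w -> is_iso (fmap loc_functor w).
Proof.
move=> hw; exists (class (@lmor_eq y x) (lm_inv hw)).
split; rewrite /= lcomp_class; apply: class_eq; try exact: lmor_equiv.
  exact: lme_invl.
exact: lme_invr.
Qed.

End Localisation.

Arguments lm_of {C W x y} _.
Arguments lm_inv {C W x y w} _.
Arguments lm_comp {C W x y z} _ _.

Lemma functor_ext (C D : Category) (F G : Functor C D)
  (eo : forall x, F x = G x) :
  (forall x y (f : Hom x y),
     eq_hom (eo y) ∘ fmap F f = fmap G f ∘ eq_hom (eo x)) -> F = G.
Proof.
case: F eo => Fo Fm F1 F2; case: G => Go Gm G1 G2 /= eo.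
have e : Fo = Go by apply: functional_extensionality.
subst Go => em.
have e : Fm = Gm.
  apply: functional_extensionality_dep => x.
  apply: functional_extensionality_dep => y.
  apply: functional_extensionality => f.
  have := em x y f.
  by rewrite (proof_irrelevance _ (eo x) eq_refl)
     (proof_irrelevance _ (eo y) eq_refl) /= comp_idl comp_idr.
by subst Gm; rewrite (proof_irrelevance _ F1 G1) (proof_irrelevance _ F2 G2).
Qed.

Lemma iso_inv_unique (C : Category) (x y : C) (f : Hom x y) (g h : Hom y x) :
  g ∘ f = idm x -> f ∘ h = idm y -> g = h.
Proof.
by move=> gf fh; rewrite -(comp_idr g) -fh comp_assoc gf comp_idl.
Qed.

Section LocalisationUniversal.
Variables (C D : Category) (W : morphism_class C) (F : Functor C D).
Hypothesis hF : forall x y (w : Hom x y), W w -> is_iso (fmap F w).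

Fixpoint leval x y (p : lmor W x y) : Hom (F x) (F y) :=
  match p with
  | lm_of f => fmap F f
  | lm_inv hw => proj1_sig (constructive_indefinite_description _ (hF hw))
  | lm_comp q p => leval q ∘ leval p
  end.

Lemma leval_eq x y (p q : lmor W x y) : lmor_eq p q -> leval p = leval q.
Proof.
elim=> {x y p q} /=.
- by [].
- by move=> *; symmetry.
- by move=> x y p q r _ -> _ ->.
- by move=> x y z q q' p p' _ -> _ ->.
- by move=> *; rewrite fmap_id comp_idl.
- by move=> *; rewrite fmap_id comp_idr.
- by move=> *; rewrite comp_assoc.
- by move=> *; rewrite fmap_comp.
- move=> x y w hw; rewrite fmap_id.
  by case: constructive_indefinite_description => g /= [].
- move=> x y w hw; rewrite fmap_id.
  by case: constructive_indefinite_description => g /= [].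
Qed.

Program Definition loc_lift : Functor (Loc W) D :=
  {| fob := fun x : Loc W => F x; fmap := fun x y p => leval (repr p) |}.
Next Obligation.
move=> x /=; rewrite (leval_eq (repr_class (lmor_equiv _ _ _) _)) /=.
exact: fmap_id.
Qed.
Next Obligation.
by move=> x y z g f /=; rewrite (leval_eq (repr_class (lmor_equiv _ _ _) _)).
Qed.

Lemma loc_lift_factors : loc_lift ⊚ loc_functor W = F.
Proof.
apply (@functor_ext C D (loc_lift ⊚ loc_functor W) F (fun x => eq_refl)).
move=> x y f /=.
by rewrite comp_idl comp_idr (leval_eq (repr_class (lmor_equiv _ _ _) _)).
Qed.

End LocalisationUniversal.

Lemma loc_lift_unique (C D : Category) (W : morphism_class C)
  (G : Functor (Loc W) D)
  (hG : forall x y (w : Hom x y), W x y w ->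
     is_iso (fmap (G ⊚ loc_functor W) w)) :
  loc_lift hG = G.
Proof.
apply (@functor_ext (Loc W) D (loc_lift hG) G (fun x => eq_refl)).
move=> x y q /=; rewrite comp_idl comp_idr -[in RHS](class_repr q).
elim: (repr q) => {q x y}.
- by [].
- move=> x y w hw /=; case: constructive_indefinite_description => g [/= gf _].
  apply: (iso_inv_unique gf).
  rewrite -fmap_comp /= lcomp_class -(fmap_id G); congr (fmap G _).
  by apply: class_eq; [apply: lmor_equiv|apply: lme_invr].
- move=> x y z q hq p hp /=; rewrite hq hp -fmap_comp; congr (fmap G _).
  by rewrite /= lcomp_class.
Qed.

Theorem loc_universal (C D : Category) (W : morphism_class C)
  (F : Functor C D) :
  (forall x y (w : Hom x y), W x y w -> is_iso (fmap F w)) ->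
  exists! G : Functor (Loc W) D, G ⊚ loc_functor W = F.
Proof.
move=> hF; exists (loc_lift hF); split; first exact: loc_lift_factors.
by move=> G e; destruct e; apply: loc_lift_unique.
Qed.

Definition Ho (C : Category) (M : ModelStructure C) : Category :=
  Loc (@weq C M).

Definition gamma (C : Category) (M : ModelStructure C) : Functor C (Ho M) :=
  loc_functor (@weq C M).

Definition Fibr (C : Category) (M : ModelStructure C) : Category :=
  FullSub (fibrant M).

Definition Hof (C : Category) (M : ModelStructure C) : Category :=
  @FullSub (Ho M) (fibrant M).

Definition gamma_f (C : Category) (M : ModelStructure C)
  : Functor (Fibr M) (Hof M) :=
  @full_restr C (Ho M) (fibrant M) (fibrant M) (gamma M) (fun _ h => h).

(* A cylinder object (Cyl, i0, i1, s) is a factorisation of the fold map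
   A + A -> A through Cyl with s a weak equivalence; (i0, i1) are the two
   components of A + A -> Cyl. *)
Definition left_homotopic (C : Category) (M : ModelStructure C) (A X : C)
  (f g : Hom A X) : Prop :=
  exists (Cyl : C) (i0 i1 : Hom A Cyl) (s : Hom Cyl A) (H : Hom Cyl X),
    s ∘ i0 = idm A /\ s ∘ i1 = idm A /\ weq M s /\
    H ∘ i0 = f /\ H ∘ i1 = g.

(* The equivalence relation generated by left homotopy.  For A cofibrant and X
   fibrant, left homotopy is already an equivalence relation on Hom A X, and
   coincides with right homotopy. *)
Definition homotopic (C : Category) (M : ModelStructure C) (A X : C)
  : relation (Hom A X) := clos_refl_sym_trans _ (@left_homotopic C M A X).

Lemma homotopic_equiv (C : Category) (M : ModelStructure C) (A X : C) :
  equivalence _ (@homotopic C M A X).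
Proof.
by split=> [f|f g h|f g]; [apply: rst_refl|apply: rst_trans|apply: rst_sym].
Qed.

Program Definition bool_cat : Category :=
  {| Ob := bool; Hom := fun x y => x = y; idm := fun x => eq_refl;
     comp := fun x y z g f => eq_trans f g |}.
Next Obligation. by move=> x y f; apply: proof_irrelevance. Qed.
Next Obligation. by move=> x y f; apply: proof_irrelevance. Qed.
Next Obligation. by move=> x y z t h g f; apply: proof_irrelevance. Qed.

Program Definition bool_diag (C : Category) (A B : C) : Functor bool_cat C :=
  {| fob := fun b : bool_cat => if b then A else B;
     fmap := fun x y (e : x = y) =>
       eq_hom (f_equal (fun b : bool => if b then A else B) e) |}.
Next Obligation. by []. Qed.
Next Obligation.
by move=> C A B x y z g f /=; destruct g, f; rewrite /= comp_idl.
Qed.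

Lemma bool_cat_finite : finite_category bool_cat.
Proof.
split; first by exists (true :: false :: nil); case=> /=; auto.
move=> x y; case: (Bool.bool_dec x y) => [e|ne].
  by exists (e :: nil) => e'; left; exact (proof_irrelevance (x = y) e e').
by exists nil => e'; case: ne.
Qed.

Lemma binary_coproduct (C : Category) (M : ModelStructure C) (A B : C) :
  exists (P : C) (u : Hom A P) (v : Hom B P),
    (forall X (f : Hom A X) (g : Hom B X),
       exists h : Hom P X, h ∘ u = f /\ h ∘ v = g) /\
    (forall X (h k : Hom P X), h ∘ u = k ∘ u -> h ∘ v = k ∘ v -> h = k).
Proof.
have [P [p [_ up]]] :=
  finite_colimits M (bool_diag A B) bool_cat_finite.
exists P, (p true), (p false); split=> [X f g|X h k hu hv].
  pose q := fun b : bool_cat =>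
    match b return Hom (bool_diag A B b) X with true => f | false => g end.
  have [|h [hq _]] := up X q.
    by move=> d d' u; destruct u; rewrite /= comp_idr.
  by exists h; split; [apply: (hq true)|apply: (hq false)].
have [|l [_ ul]] := up X (fun b => h ∘ p b).
  by move=> d d' u; destruct u; rewrite /= comp_idr.
rewrite -(ul h) // -(ul k) //.
by case.
Qed.

Lemma fibrant_extend (C : Category) (M : ModelStructure C) (X A B : C)
  (i : Hom A B) (f : Hom A X) :
  fibrant M X -> cof M i -> weq M i -> exists g : Hom B X, g ∘ i = f.
Proof.
move=> [T [t [hT ft]]] ci wi.
have [b _] := hT B; have [a [_ ua]] := hT A.
have [|g [gi _]] := lift_accof_fib ci wi ft (u := f) (v := b).
  by rewrite -(ua (t ∘ f)) // -(ua (b ∘ i)).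
by exists g.
Qed.

Lemma left_homotopic_precomp (C : Category) (M : ModelStructure C)
  (A B X : C) (f g : Hom B X) (h : Hom A B) :
  fibrant M X -> left_homotopic M f g -> left_homotopic M (f ∘ h) (g ∘ h).
Proof.
move=> hX [Cyl [i0 [i1 [s [H [si0 [si1 [ws [Hi0 Hi1]]]]]]]]].
have [Z [j [q [sqj [cj [wj fq]]]]]] := factor_accof_fib M s.
have wq : weq M q by apply: (weq_cancel_r wj); rewrite -sqj.
have [H' H'j] := fibrant_extend H hX cj wj.
have [P [u [v [Pex Pun]]]] := binary_coproduct M A A.
have [fold [fu fv]] := Pex _ (idm A) (idm A).
have [CA [k [r [frk [ck [fr wr]]]]]] := factor_cof_acfib M fold.
have [m [mu mv]] := Pex _ (j ∘ i0 ∘ h) (j ∘ i1 ∘ h).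
have [|l [lk ql]] := lift_cof_acfib ck fq wq (u := m) (v := h ∘ r).
  rewrite -comp_assoc -frk; apply: Pun; rewrite -!comp_assoc ?mu ?mv ?fu ?fv.
    by rewrite !comp_assoc -sqj si0 comp_idl comp_idr.
  by rewrite !comp_assoc -sqj si1 comp_idl comp_idr.
exists CA, (k ∘ u), (k ∘ v), r, (H' ∘ l).
rewrite !comp_assoc -!frk fu fv; split=> //; split=> //; split=> //.
rewrite -!(comp_assoc H') lk mu mv !comp_assoc H'j.
by rewrite -Hi0 -Hi1.
Qed.

Lemma homotopic_precomp (C : Category) (M : ModelStructure C)
  (A B X : C) (f g : Hom B X) (h : Hom A B) :
  fibrant M X -> homotopic M f g -> homotopic M (f ∘ h) (g ∘ h).
Proof.
move=> hX; elim=> {f g}.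
- by move=> f g fg; apply: rst_step; apply: left_homotopic_precomp.
- by move=> f; apply: rst_refl.
- by move=> f g _; apply: rst_sym.
- by move=> f g k _ h1 _ h2; apply: rst_trans h1 h2.
Qed.

Lemma homotopic_postcomp (C : Category) (M : ModelStructure C)
  (A X Y : C) (f g : Hom A X) (h : Hom X Y) :
  homotopic M f g -> homotopic M (h ∘ f) (h ∘ g).
Proof.
elim=> {f g}.
- move=> f g [Cyl [i0 [i1 [s [H [si0 [si1 [ws [Hi0 Hi1]]]]]]]]].
  apply: rst_step; exists Cyl, i0, i1, s, (h ∘ H).
  by rewrite -!comp_assoc Hi0 Hi1.
- by move=> f; apply: rst_refl.
- by move=> f g _; apply: rst_sym.
- by move=> f g k _ h1 _ h2; apply: rst_trans h1 h2.
Qed.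

Section BifibrantHomotopy.
Variables (C : Category) (M : ModelStructure C).

Definition bifibrant (X : C) : Prop := fibrant M X /\ cofibrant M X.

Definition hclass (A X : C) (f : Hom A X) : quot (@homotopic C M A X) :=
  class (@homotopic C M A X) f.

Lemma hclass_compr (A B X : C) (g : Hom B X) (f : Hom A B) :
  hclass (g ∘ repr (hclass f)) = hclass (g ∘ f).
Proof.
apply: class_eq; first exact: homotopic_equiv.
apply: homotopic_postcomp.
exact: repr_class (homotopic_equiv _ _ _) f.
Qed.

Lemma hclass_compl (A B X : C) (g : Hom B X) (f : Hom A B) : fibrant M X ->
  hclass (repr (hclass g) ∘ f) = hclass (g ∘ f).
Proof.
move=> hX; apply: class_eq; first exact: homotopic_equiv.
apply: homotopic_precomp => //.
exact: repr_class (homotopic_equiv _ _ _) g.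
Qed.

Program Definition BifibrantHo : Category :=
  {| Ob := {X : C | bifibrant X};
     Hom := fun X Y => quot (@homotopic C M (proj1_sig X) (proj1_sig Y));
     idm := fun X => hclass (idm (proj1_sig X));
     comp := fun X Y Z g f => hclass (repr g ∘ repr f) |}.
Next Obligation.
move=> X [Y [fY cY]] f /=.
by rewrite hclass_compl //= comp_idl /hclass class_repr.
Qed.
Next Obligation.
by move=> X Y f /=; rewrite hclass_compr comp_idr /hclass class_repr.
Qed.
Next Obligation.
move=> X Y Z [T [fT cT]] h g f /=.
by rewrite hclass_compr hclass_compl // comp_assoc.
Qed.

Variables (D : Category) (G : Functor (FullSub bifibrant) D).
Hypothesis hG : forall (X Y : FullSub bifibrant) (f g : Hom X Y),
  @left_homotopic C M (proj1_sig X) (proj1_sig Y) f g -> fmap G f = fmap G g.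

Lemma homotopic_fmap (X Y : FullSub bifibrant) (f g : Hom X Y) :
  @homotopic C M (proj1_sig X) (proj1_sig Y) f g -> fmap G f = fmap G g.
Proof.
elim=> {f g}.
- by move=> f g; apply: hG.
- by [].
- by move=> f g _ ->.
- by move=> f g h _ -> _ ->.
Qed.

Program Definition bifibrant_induced : Functor BifibrantHo D :=
  {| fob := fun X : BifibrantHo => G X;
     fmap := fun X Y f => fmap G (repr f : @Hom (FullSub bifibrant) X Y) |}.
Next Obligation.
move=> X; rewrite -fmap_id; apply: homotopic_fmap.
exact: repr_class (homotopic_equiv _ _ _) _.
Qed.
Next Obligation.
move=> X Y Z g f; rewrite -fmap_comp; apply: homotopic_fmap.
exact: repr_class (homotopic_equiv _ _ _) _.
Qed.

End BifibrantHomotopy.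

Lemma gamma_left_homotopic (C : Category) (M : ModelStructure C) (A X : C)
  (f g : Hom A X) :
  left_homotopic M f g -> fmap (gamma M) f = fmap (gamma M) g.
Proof.
move=> [Cyl [i0 [i1 [s [H [si0 [si1 [ws [<- <-]]]]]]]]].
rewrite !fmap_comp; congr comp.
have [t [ts st]] := loc_inverts ws.
rewrite -(comp_idl (fmap _ i0)) -(comp_idl (fmap _ i1)) -!ts -!comp_assoc.
by rewrite -!fmap_comp si0 si1.
Qed.

Definition nu (C : Category) (M : ModelStructure C)
  : Functor (BifibrantHo M) (Ho M) :=
  @bifibrant_induced C M (Ho M) (gamma M ⊚ full_incl (bifibrant M))
    (fun X Y f g => @gamma_left_homotopic C M _ _ f g).

Record AdjunctionBundle (I : Category) (C : I -> Category) := {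
  bF : forall i j, @Hom I i j -> Functor (C i) (C j);
  bU : forall i j, @Hom I i j -> Functor (C j) (C i);
  badj : forall i j (s : @Hom I i j), Adjunction (bF s) (bU s);
  bF_id : forall i, bF (idm i) = Idf (C i);
  bU_id : forall i, bU (idm i) = Idf (C i);
  bU_comp : forall i j k (t : Hom j k) (s : Hom i j),
    bU (t ∘ s) = bU s ⊚ bU t }.

Section TwistedDiagrams.
Variables (I : Category) (C : I -> Category) (B : AdjunctionBundle C).

Record TwistedDiagram := {
  tob :> forall i, C i;
  tflat : forall i j (s : @Hom I i j), Hom (tob i) (bU B s (tob j));
  tflat_id : forall i,
    eq_hom (functor_eq_ob (bU_id B i) (tob i)) ∘ tflat (idm i) = idm (tob i);
  tflat_comp : forall i j k (t : @Hom I j k) (s : @Hom I i j),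
    eq_hom (functor_eq_ob (bU_comp B t s) (tob k)) ∘ tflat (t ∘ s)
    = fmap (bU B s) (tflat t) ∘ tflat s }.

Definition tsharp (Y : TwistedDiagram) (i j : I) (s : @Hom I i j)
  : Hom (bF B s (Y i)) (Y j) := sharp_of (badj B s) (tflat Y s).

Definition is_twmap (Y Z : TwistedDiagram) (f : forall i, Hom (Y i) (Z i)) :=
  forall i j (s : @Hom I i j),
    fmap (bU B s) (f j) ∘ tflat Y s = tflat Z s ∘ f i.

Definition TwMap (Y Z : TwistedDiagram) : Type :=
  {f : forall i, Hom (Y i) (Z i) | is_twmap f}.

Definition twc (Y Z : TwistedDiagram) (f : TwMap Y Z) i : Hom (Y i) (Z i) :=
  proj1_sig f i.

Lemma twmap_eq (Y Z : TwistedDiagram) (f g : TwMap Y Z) :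
  (forall i, twc f i = twc g i) -> f = g.
Proof.
case: f => f hf; case: g => g hg /= e.
by apply: subset_eq_compat; apply: functional_extensionality_dep.
Qed.

Program Definition Tw : Category :=
  {| Ob := TwistedDiagram;
     Hom := TwMap;
     idm := fun Y => exist _ (fun i => idm (Y i)) _;
     comp := fun X Y Z g f => exist _ (fun i => twc g i ∘ twc f i) _ |}.
Next Obligation.
by move=> Y i j s; rewrite fmap_id comp_idl comp_idr.
Qed.
Next Obligation.
move=> X Y Z g f i j s.
rewrite fmap_comp -comp_assoc (proj2_sig f i j s) comp_assoc.
by rewrite (proj2_sig g i j s) -comp_assoc.
Qed.
Next Obligation. by move=> *; apply: twmap_eq => i; apply: comp_idl. Qed.
Next Obligation. by move=> *; apply: twmap_eq => i; apply: comp_idr. Qed.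
Next Obligation. by move=> *; apply: twmap_eq => i; apply: comp_assoc. Qed.

Definition left_strict_sheaf (Y : Tw) : Prop :=
  forall i j (s : @Hom I i j), is_iso (tsharp Y s).

End TwistedDiagrams.

Section ModelBundles.
Variables (I : Category) (C : I -> Category).
Variables (M : forall i, ModelStructure (C i)) (B : AdjunctionBundle C).

Definition model_bundle : Prop :=
  forall i j (s : @Hom I i j),
    (forall x y (f : @Hom (C i) x y), cof (M i) f -> cof (M j) (fmap (bF B s) f))
    /\ (forall x y (f : @Hom (C i) x y),
          acyclic_cof (M i) f -> acyclic_cof (M j) (fmap (bF B s) f)).

Definition pointwise_weq (Y Z : Tw B) (f : Hom Y Z) : Prop :=
  forall i, weq (M i) (twc f i).

Definition pointwise_fibrant (Y : Tw B) : Prop :=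
  forall i, fibrant (M i) (Y i).

Definition left_homotopy_sheaf (Y : Tw B) : Prop :=
  forall i j (s : @Hom I i j),
    exists (Ybar : C i) (p : Hom Ybar (Y i)),
      acyclic_fib (M i) p /\ cofibrant (M i) Ybar /\
      weq (M j) (sharp_of (badj B s) (tflat Y s ∘ p)).

End ModelBundles.

Lemma fib_of_lifting (C : Category) (M : ModelStructure C) (x y : C)
  (p : Hom x y) :
  (forall a b (i : Hom a b), acyclic_cof M i -> has_lifting i p) -> fib M p.
Proof.
move=> hp; have [z [i [q [pqi [ci [wi fq]]]]]] := factor_accof_fib M p.
have [|h [hi ph]] := hp _ _ i (conj ci wi) (idm x) q.
  by rewrite comp_idr.
apply: fib_retract fq; exists i, h, (idm y), (idm y).
by rewrite comp_idl !comp_idl -pqi ph.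
Qed.

Lemma flat_inj (C D : Category) (F : Functor C D) (U : Functor D C)
  (a : Adjunction F U) x y (f g : Hom (F x) y) :
  flat_of a f = flat_of a g -> f = g.
Proof. by move=> e; rewrite -(sharp_flat a f) e sharp_flat. Qed.

Lemma right_adjoint_fibrant (C D : Category) (MC : ModelStructure C)
  (MD : ModelStructure D) (F : Functor C D) (U : Functor D C)
  (a : Adjunction F U) :
  (forall x y (f : @Hom C x y),
     acyclic_cof MC f -> acyclic_cof MD (fmap F f)) ->
  forall X, fibrant MD X -> fibrant MC (U X).
Proof.
move=> hF X [T [t [hT ft]]]; exists (U T), (fmap U t); split.
  move=> Z; have [f [_ uf]] := hT (F Z).
  exists (flat_of a f); split=> // g _.
  by rewrite -(flat_sharp a g) (uf (sharp_of a g)).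
apply: fib_of_lifting => b c i hi u v uv.
have [cFi wFi] := hF _ _ _ hi.
have [|h [hu hv]] := lift_accof_fib cFi wFi ft (u := sharp_of a u)
  (v := sharp_of a v).
  by apply: (@flat_inj _ _ _ _ a); rewrite flat_natr flat_natl !flat_sharp.
exists (flat_of a h); split.
  by rewrite -flat_natl hu flat_sharp.
by rewrite -flat_natr hv flat_sharp.
Qed.

Definition U_fibrant (I : Category) (C : I -> Category)
  (M : forall i, ModelStructure (C i)) (B : AdjunctionBundle C)
  (hB : model_bundle M B) (i j : I) (s : @Hom I i j)
  : forall X, fibrant (M j) X -> fibrant (M i) (bU B s X) :=
  right_adjoint_fibrant (badj B s) (proj2 (hB i j s)).

(* The derived functors are pinned down by their characterisations: R_f U is the
   functor on Ho_f induced by U (unique, as gamma_f is a localisation), and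
   L_f F is a left adjoint of it with the prescribed objects.  The laws of
   AdjunctionBundle give L_f id = id for identity morphisms of I; if F_s happens
   to be an identity functor for another s, L_f F_s may be either the identity
   or given by the formula, so no constraint on objects is imposed. *)
Record HomotopyBundle (I : Category) (C : I -> Category)
  (M : forall i, ModelStructure (C i)) (rep : forall i, Replacements (M i))
  (B : AdjunctionBundle C) (hB : model_bundle M B) := {
  hob :> AdjunctionBundle (fun i => Hof (M i));
  hob_R : forall i j (s : @Hom I i j),
    bU hob s ⊚ gamma_f (M j)
    = gamma_f (M i) ⊚ full_restr (U_fibrant hB s);
  hob_L : forall i j (s : @Hom I i j), ~ is_identity_functor (bF B s) ->
    forall X : Hof (M i),
      proj1_sig (bF hob s X)
      = fib_repl (rep j) (bF B s (cof_repl (rep i) (proj1_sig X))) }.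

Lemma eq_hom_irr (C : Category) (x y : C) (e e' : x = y) : eq_hom e = eq_hom e'.
Proof. by rewrite (proof_irrelevance _ e e'). Qed.

Lemma eq_hom_loop (C : Category) (x : C) (e : x = x) : eq_hom e = idm x.
Proof. exact: (eq_hom_irr e eq_refl). Qed.

Lemma eq_hom_comp (C : Category) (x y z : C) (e : x = y) (e' : y = z) :
  eq_hom e' ∘ eq_hom e = eq_hom (eq_trans e e').
Proof. by destruct e'; rewrite /= comp_idl. Qed.

Lemma eq_hom_fmap (C D : Category) (F : Functor C D) (x y : C) (e : x = y) :
  fmap F (eq_hom e) = eq_hom (f_equal (fob F) e).
Proof. by destruct e; rewrite /= fmap_id. Qed.

Lemma functor_eq_nat (C D : Category) (F G : Functor C D) (e : F = G)
  (x y : C) (f : Hom x y) :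
  eq_hom (functor_eq_ob e y) ∘ fmap F f = fmap G f ∘ eq_hom (functor_eq_ob e x).
Proof. by destruct e; rewrite /= comp_idl comp_idr. Qed.

Lemma functor_eq_nat_sym (C D : Category) (F G : Functor C D) (e : F = G)
  (x y : C) (f : Hom x y) :
  fmap F f ∘ eq_hom (eq_sym (functor_eq_ob e x))
  = eq_hom (eq_sym (functor_eq_ob e y)) ∘ fmap G f.
Proof. by destruct e; rewrite /= comp_idl comp_idr. Qed.

Lemma eq_hom_cancel (C : Category) (x y z : C) (e : y = z) (f : Hom x y)
  (g : Hom x z) : eq_hom e ∘ f = g -> f = eq_hom (eq_sym e) ∘ g.
Proof. by move=> <-; destruct e; rewrite /= !comp_idl. Qed.

Lemma full_eq_hom (C : Category) (P : C -> Prop) (x y : FullSub P)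
  (e : proj1_sig x = proj1_sig y) :
  exists e' : x = y, (eq_hom e' : Hom (proj1_sig x) (proj1_sig y)) = eq_hom e.
Proof.
case: x y e => x hx [y hy] /= e; destruct e.
have e : hx = hy by apply: proof_irrelevance.
by destruct e; exists eq_refl.
Qed.

Section Gamma.
Variables (I : Category) (C : I -> Category).
Variables (M : forall i, ModelStructure (C i)) (rep : forall i, Replacements (M i)).
Variables (B : AdjunctionBundle C) (hB : model_bundle M B).
Variable (H : HomotopyBundle rep hB).

Definition Gamma_tob (Y : FullSub (@pointwise_fibrant I C M B)) (i : I)
  : Fibr (M i) := exist _ (proj1_sig Y i) (proj2_sig Y i).

(* The maps y_s of a pointwise fibrant diagram, as morphisms of C_i^f. *)
Definition fibr_flat (Y : FullSub (@pointwise_fibrant I C M B)) (i j : I)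
  (s : @Hom I i j)
  : Hom (Gamma_tob Y i) (full_restr (U_fibrant hB s) (Gamma_tob Y j))
  := tflat (proj1_sig Y) s.

Definition Gamma_tflat (Y : FullSub (@pointwise_fibrant I C M B)) (i j : I)
  (s : @Hom I i j)
  : Hom (gamma_f (M i) (Gamma_tob Y i)) (bU H s (gamma_f (M j) (Gamma_tob Y j)))
  := eq_hom (eq_sym (functor_eq_ob (hob_R H s) (Gamma_tob Y j)))
     ∘ fmap (gamma_f (M i)) (fibr_flat Y s).

Lemma hob_R_nat (i j : I) (s : @Hom I i j) (X X' : Fibr (M j))
  (f : Hom X X') :
  fmap (bU H s) (fmap (gamma_f (M j)) f)
    ∘ eq_hom (eq_sym (functor_eq_ob (hob_R H s) X))
  = eq_hom (eq_sym (functor_eq_ob (hob_R H s) X'))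
    ∘ fmap (gamma_f (M i)) (fmap (full_restr (U_fibrant hB s)) f).
Proof. exact: (functor_eq_nat_sym (hob_R H s) f). Qed.

Program Definition Gamma_ob (Y : FullSub (@pointwise_fibrant I C M B))
  : Tw H :=
  {| tob := fun i => gamma_f (M i) (Gamma_tob Y i);
     tflat := fun i j s => Gamma_tflat Y s |}.
Next Obligation.
move=> Y i; rewrite /Gamma_tflat.
have /eq_hom_cancel := tflat_id (proj1_sig Y) i.
rewrite comp_idr => e.
have [e' he'] := @full_eq_hom _ (fibrant (M i)) (Gamma_tob Y i)
  (full_restr (U_fibrant hB (idm i)) (Gamma_tob Y i))
  (eq_sym (functor_eq_ob (bU_id B i) (proj1_sig Y i))).
have -> : fibr_flat Y (idm i) = eq_hom e' by rewrite he'; apply: e.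
rewrite eq_hom_fmap !eq_hom_comp.
exact: eq_hom_loop.
Qed.
Next Obligation.
move=> Y i j k t s; rewrite /Gamma_tflat.
have /eq_hom_cancel := tflat_comp (proj1_sig Y) t s.
set e0 := eq_sym _ => e.
pose UUk : Fibr (M i) := full_restr (U_fibrant hB s)
  (full_restr (U_fibrant hB t) (Gamma_tob Y k)).
have [e' he'] := @full_eq_hom _ (fibrant (M i)) UUk
  (full_restr (U_fibrant hB (t ∘ s)) (Gamma_tob Y k)) e0.
have -> : fibr_flat Y (t ∘ s)
  = eq_hom e' ∘ (fmap (full_restr (U_fibrant hB s)) (fibr_flat Y t)
                 ∘ fibr_flat Y s).
  by rewrite he'; apply: e.
rewrite !fmap_comp !eq_hom_fmap.
rewrite -[RHS]comp_assoc [X in _ = _ ∘ X]comp_assoc hob_R_nat.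
rewrite !comp_assoc !eq_hom_comp.
congr (_ ∘ _ ∘ _); exact: eq_hom_irr.
Qed.

Definition fibr_map (Y Z : FullSub (@pointwise_fibrant I C M B))
  (f : Hom Y Z) (i : I) : Hom (Gamma_tob Y i) (Gamma_tob Z i) := twc f i.

Program Definition Gamma
  : Functor (FullSub (@pointwise_fibrant I C M B)) (Tw H) :=
  {| fob := Gamma_ob;
     fmap := fun Y Z f =>
       exist _ (fun i => fmap (gamma_f (M i)) (fibr_map f i)) _ |}.
Next Obligation.
move=> Y Z f i j s.
have e : fmap (full_restr (U_fibrant hB s)) (fibr_map f j) ∘ fibr_flat Y s
  = fibr_flat Z s ∘ fibr_map f i by apply: (proj2_sig f i j s).
rewrite -[LHS]/(fmap (bU H s) (fmap (gamma_f (M j)) (fibr_map f j))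
  ∘ Gamma_tflat Y s).
rewrite -[RHS]/(Gamma_tflat Z s ∘ fmap (gamma_f (M i)) (fibr_map f i)).
by rewrite comp_assoc hob_R_nat -!comp_assoc -!fmap_comp e.
Qed.
Next Obligation.
by move=> Y; apply: twmap_eq => i; apply: fmap_id.
Qed.
Next Obligation.
move=> X Y Z g f; apply: twmap_eq => i.
exact: (fmap_comp (gamma_f (M i)) (fibr_map g i) (fibr_map f i)).
Qed.

End Gamma.

(* A natural weak equivalence to fibrant objects; the maps X -> R X are not
   required to be cofibrations. *)
Record FibrantReplacementFunctor (C : Category) (M : ModelStructure C) := {
  frf :> Functor C C;
  frf_map : forall X, Hom X (frf X);
  frf_nat : forall X Y (f : Hom X Y),
    frf_map Y ∘ f = fmap frf f ∘ frf_map X;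
  frf_weq : forall X, weq M (frf_map X);
  frf_fibrant : forall X, fibrant M (frf X) }.

Section Hbar.
Variables (I : Category) (C : I -> Category).
Variables (M : forall i, ModelStructure (C i)) (rep : forall i, Replacements (M i)).
Variables (B : AdjunctionBundle C) (hB : model_bundle M B).
Variable (H : HomotopyBundle rep hB).
Variables (T : ModelStructure (Tw B)).
Hypothesis hT : forall (Y Z : Tw B) (f : Hom Y Z),
  weq T f <-> pointwise_weq M f.

Definition fibrant_pointwise : Prop :=
  forall Y : Tw B, fibrant T Y -> pointwise_fibrant M Y.

Definition bifibrant_Gamma (hpw : fibrant_pointwise)
  : Functor (FullSub (bifibrant T)) (Tw H) :=
  Gamma H ⊚ full_lift (F := full_incl (bifibrant T))
              (fun Y => hpw _ (proj1 (proj2_sig Y))).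

Lemma bifibrant_Gamma_homotopic (hpw : fibrant_pointwise)
  (Y Z : FullSub (bifibrant T)) (f g : Hom Y Z) :
  @left_homotopic _ T (proj1_sig Y) (proj1_sig Z) f g ->
  fmap (bifibrant_Gamma hpw) f = fmap (bifibrant_Gamma hpw) g.
Proof.
move=> [Cyl [i0 [i1 [s [h [si0 [si1 [/hT ws [hi0 hi1]]]]]]]]].
apply: twmap_eq => i; apply: (@gamma_left_homotopic _ (M i)).
exists (Cyl i), (twc i0 i), (twc i1 i), (twc s i), (twc h i).
have tw_comp (P Q R : Tw B) (u : Hom Q R) (v : Hom P Q) :
  twc u i ∘ twc v i = twc (u ∘ v) i by [].
rewrite !tw_comp si0 si1 hi0 hi1.
by repeat split; apply: ws.
Qed.

Definition phi (hpw : fibrant_pointwise) : Functor (BifibrantHo T) (Tw H) :=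
  bifibrant_induced (bifibrant_Gamma_homotopic hpw).

Variable hbar : Functor (Ho T) (Tw H).

(* As gamma T is a localisation, the equations below determine hbar: it is the
   functor induced by Y |-> Gamma(Y), resp. by Y |-> Gamma(R Y). *)
Definition hbar_case1 : Prop :=
  exists hfib : forall i (X : C i), fibrant (M i) X,
    hbar ⊚ gamma T
    = Gamma H ⊚ full_lift (F := Idf (Tw B)) (fun Y i => hfib i (tob Y i)).

Definition hbar_case2 : Prop :=
  exists (hpw : fibrant_pointwise) (R : FibrantReplacementFunctor T),
    hbar ⊚ gamma T
    = Gamma H ⊚ full_lift (F := R) (fun Y => hpw _ (frf_fibrant R Y)).

Definition hbar_case3 : Prop :=
  exists (hpw : fibrant_pointwise) (mu : Functor (Ho T) (BifibrantHo T)),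
    nat_isomorphic (nu T ⊚ mu) (Idf _) /\
    nat_isomorphic (mu ⊚ nu T) (Idf _) /\
    hbar = phi hpw ⊚ mu.

End Hbar.

(* Main.v *)
From Stdlib Require Import ssreflect.
From Stdlib Require Import Relations ClassicalEpsilon FunctionalExtensionality.
Require Import Defs.

(** Only the maps of a single arrow of the index category matter.  Call an
    arrow [g : x -> U y] universal when every [x -> U z] factors as [U h ∘ g]
    for exactly one [h]; for an adjoint pair this says that the adjoint of [g]
    is an isomorphism ([sharp_iso_universal]).  Universality does not mention
    the left adjoint, so whether [Gamma Z] is a strict sheaf can be decided
    without knowing the derived left adjoints: what is needed is that, for
    [Z] pointwise fibrant and an arrow [s] of the index category from [i] to
    [j], the class of [Z_i -> U Z_j] in the homotopy category is universal for
    the functor induced by [U] exactly when [F A -> Z_j] is a weak equivalence,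
    where [A -> Z_i] is a weak equivalence from a cofibrant object
    ([derived_universal_iff_weq]).

    To see this, factor [F A -> Z_j] as an acyclic cofibration [F A -> Z']
    followed by a fibration [k : Z' -> Z_j].  The class of the adjoint
    [A -> U Z'] is always universal ([derived_unit_universal]): maps out of
    cofibrant objects into fibrant ones represent all morphisms of the homotopy
    category, up to homotopy, and homotopies of maps [A -> U W] correspond to
    homotopies of maps [F A -> W] because [F] preserves cylinders.  Hence the
    class of [Z_i -> U Z_j] is universal iff the class of [k] is an isomorphism,
    and since weak equivalences are exactly the maps that become isomorphisms in
    the homotopy category ([weq_of_iso]), iff [k] is a weak equivalence.

    The facts about the homotopy category used here, for the localisation by
    formal inverses, come from one Yoneda argument.  For [A] cofibrant with a
    chosen cylinder, and [R X] a fibrant replacement of [X], the homotopy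
    classes of maps [A -> R X] are functorial in [X] and weak equivalences act
    on them bijectively; so the whole localisation acts on them, and following
    the class of [A -> R A] shows that they classify the morphisms from [A] to
    [X] in the homotopy category ([ho_classes_classify], [gamma_full],
    [gamma_faithful]).

    Finally, left homotopy sheaves are invariant under pointwise weak
    equivalences ([left_homotopy_sheaf_weq]) by Ken Brown's lemma for [F].  In
    each of the three constructions [hbar Y] is [Gamma Z] for a pointwise
    fibrant [Z] joined to [Y] by weak equivalences: [Z = Y] in the first,
    [Y -> Z] in the second, and [Y -> X' <- Z] in the third
    ([fibrant_roof]). *)

Set Implicit Arguments.
Unset Strict Implicit.
Unset Printing Implicit Defensive.
#[local] Set Bullet Behavior "None".
#[local] Obligation Tactic := idtac.

(** * Isomorphisms and morphisms of a localisation *)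

Lemma is_iso_comp (C : Category) (x y z : C) (g : Hom y z) (f : Hom x y) :
  is_iso g -> is_iso f -> is_iso (g ∘ f).
Proof.
move=> [g' [gg1 gg2]] [f' [ff1 ff2]]; exists (f' ∘ g'); split.
  by rewrite comp_assoc -(comp_assoc f') gg1 comp_idr.
by rewrite comp_assoc -(comp_assoc g) ff2 comp_idr.
Qed.

Lemma is_iso_eq_hom (C : Category) (x y : C) (e : x = y) : is_iso (eq_hom e).
Proof. by destruct e; exists (idm x); rewrite /= comp_idl. Qed.

Lemma is_iso_cancel_l (C : Category) (x y z : C) (g : Hom y z) (f : Hom x y) :
  is_iso g -> is_iso (g ∘ f) -> is_iso f.
Proof.
move=> [g' [gg1 gg2]] hgf.
have -> : f = g' ∘ (g ∘ f) by rewrite comp_assoc gg1 comp_idl.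
by apply: is_iso_comp => //; exists g.
Qed.

Lemma is_iso_cancel_r (C : Category) (x y z : C) (g : Hom y z) (f : Hom x y) :
  is_iso f -> is_iso (g ∘ f) -> is_iso g.
Proof.
move=> [f' [ff1 ff2]] hgf.
have -> : g = g ∘ f ∘ f' by rewrite -comp_assoc ff2 comp_idr.
by apply: is_iso_comp => //; exists f.
Qed.

Lemma is_iso_mono (C : Category) (x y z : C) (g : Hom y z) (f f' : Hom x y) :
  is_iso g -> g ∘ f = g ∘ f' -> f = f'.
Proof.
move=> [g' [gg _]] e; rewrite -(comp_idl f) -gg -comp_assoc e.
by rewrite comp_assoc gg comp_idl.
Qed.

Lemma is_iso_epi (C : Category) (x y z : C) (g g' : Hom y z) (f : Hom x y) :
  is_iso f -> g ∘ f = g' ∘ f -> g = g'.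
Proof.
move=> [f' [_ ff]] e; rewrite -(comp_idr g) -ff comp_assoc e.
by rewrite -comp_assoc ff comp_idr.
Qed.

(** Every morphism of the localisation is a word in images of morphisms and
    inverses of such images. *)
Lemma loc_ind (C : Category) (W : morphism_class C)
  (P : forall x y : C, @Hom (Loc W) x y -> Prop) :
  (forall x y (f : Hom x y), P x y (fmap (loc_functor W) f)) ->
  (forall x y z (g : @Hom (Loc W) y z) (f : @Hom (Loc W) x y),
     P y z g -> P x y f -> P x z (g ∘ f)) ->
  (forall x y (f : @Hom (Loc W) x y) (g : @Hom (Loc W) y x),
     g ∘ f = idm x -> f ∘ g = idm y -> P x y f -> P y x g) ->
  forall x y (f : @Hom (Loc W) x y), P x y f.
Proof.
move=> Pof Pcomp Pinv x y f; rewrite -(class_repr f).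
elim: (repr f) => {f x y}.
- exact: Pof.
- move=> x y w hw; apply: (Pinv _ _ (fmap (loc_functor W) w)); [| |exact: Pof].
    by rewrite /= lcomp_class; apply: class_eq; [apply: lmor_equiv|apply: lme_invl].
  by rewrite /= lcomp_class; apply: class_eq; [apply: lmor_equiv|apply: lme_invr].
- move=> x y z q Pq p Pp; rewrite -(lcomp_class q p).
  exact: (Pcomp _ _ _ (class _ q : @Hom (Loc W) y z)
                      (class _ p : @Hom (Loc W) x y)).
Qed.

(** * Model categories *)

Section Basics.
Variables (C : Category) (M : ModelStructure C).

Lemma terminal_eq (T X : C) (f g : Hom X T) : terminal T -> f = g.
Proof. by move=> hT; have [h [_ uh]] := hT X; rewrite -(uh f) // -(uh g). Qed.

Lemma initial_eq (T X : C) (f g : Hom T X) : initial T -> f = g.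
Proof. by move=> hT; have [h [_ uh]] := hT X; rewrite -(uh f) // -(uh g). Qed.

Lemma gamma_weq_iso (x y : C) (w : Hom x y) : weq M w ->
  is_iso (fmap (gamma M) w).
Proof. exact: loc_inverts. Qed.

(** The retract argument: factor [i] as a cofibration followed by an acyclic
    fibration; a lift exhibits [i] as a retract of the cofibration. *)
Lemma cof_of_lifting (a b : C) (i : Hom a b) :
  (forall x y (p : Hom x y), acyclic_fib M p -> has_lifting i p) -> cof M i.
Proof.
move=> hi; have [z [j [q [iqj [cj [fq wq]]]]]] := factor_cof_acfib M i.
have [|h [hj qh]] := hi _ _ q (conj fq wq) j (idm b).
  by rewrite comp_idl.
apply: cof_retract cj; exists (idm a), (idm a), h, q.
by rewrite comp_idl !comp_idr hj -iqj.
Qed.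

Lemma cofibrant_cof (A B : C) (i : Hom A B) :
  cofibrant M A -> cof M i -> cofibrant M B.
Proof.
move=> [T [t [hT ct]]] ci; exists T, (i ∘ t).
by split=> //; apply: cof_comp.
Qed.

Lemma fibrant_fib (X Y : C) (p : Hom X Y) :
  fibrant M Y -> fib M p -> fibrant M X.
Proof.
move=> [T [t [hT ft]]] fp; exists T, (t ∘ p).
by split=> //; apply: fib_comp.
Qed.

Lemma cofibrant_lift (A X Y : C) (p : Hom X Y) (f : Hom A Y) :
  cofibrant M A -> acyclic_fib M p -> exists g : Hom A X, p ∘ g = f.
Proof.
move=> [T [t [hT ct]]] [fp wp].
have [b _] := hT X.
have [|g [_ pg]] := lift_cof_acfib ct fp wp (u := b) (v := f).
  exact: initial_eq.
by exists g.
Qed.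

Definition empty_cat : Category.
Proof.
by refine {| Ob := Empty_set; Hom := fun x y => unit; idm := fun _ => tt;
  comp := fun _ _ _ _ _ => tt |} => - [].
Defined.

Definition empty_diagram : Functor empty_cat C.
Proof.
by refine {| fob := fun x : empty_cat => match x with end;
  fmap := fun x => match x with end |} => - [].
Defined.

Lemma empty_cat_finite : finite_category empty_cat.
Proof. by split; [exists nil => - [] | case]. Qed.

Lemma terminal_ex : exists T : C, terminal T.
Proof.
have [T [p [_ up]]] := finite_limits M empty_diagram empty_cat_finite.
exists T => X.
have [|h [_ uh]] := up X (fun d : empty_cat => match d with end); first by case.
by exists h; split=> // k _; apply: uh; case.
Qed.

Lemma initial_ex : exists T : C, initial T.
Proof.
have [T [p [_ up]]] := finite_colimits M empty_diagram empty_cat_finite.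
exists T => X.
have [|h [_ uh]] := up X (fun d : empty_cat => match d with end); first by case.
by exists h; split=> // k _; apply: uh; case.
Qed.

Lemma fibrant_approximation (X : C) :
  exists (X' : C) (q : Hom X X'), acyclic_cof M q /\ fibrant M X'.
Proof.
have [T hT] := terminal_ex; have [t _] := hT X.
have [X' [q [p [_ [cq [wq fp]]]]]] := factor_accof_fib M t.
by exists X', q; split; [split | exists T, p].
Qed.

Lemma cofibrant_approximation (X : C) :
  exists (X' : C) (p : Hom X' X), acyclic_fib M p /\ cofibrant M X'.
Proof.
have [T hT] := initial_ex; have [t _] := hT X.
have [X' [i [p [_ [ci [fp wp]]]]]] := factor_cof_acfib M t.
by exists X', p; split; [split | exists T, i].
Qed.

Lemma binary_product (A B : C) :
  exists (P : C) (u : Hom P A) (v : Hom P B),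
    (forall X (f : Hom X A) (g : Hom X B),
       exists h : Hom X P, u ∘ h = f /\ v ∘ h = g) /\
    (forall X (h k : Hom X P), u ∘ h = u ∘ k -> v ∘ h = v ∘ k -> h = k).
Proof.
have [P [p [_ up]]] := finite_limits M (bool_diag A B) bool_cat_finite.
exists P, (p true), (p false); split=> [X f g|X h k hu hv].
  pose q := fun b : bool_cat =>
    match b return Hom X (bool_diag A B b) with true => f | false => g end.
  have [|h [hq _]] := up X q.
    by move=> d d' u; destruct u; rewrite /= comp_idl.
  by exists h; split; [apply: (hq true)|apply: (hq false)].
have [|l [_ ul]] := up X (fun b => p b ∘ h).
  by move=> d d' u; destruct u; rewrite /= comp_idl.
rewrite -(ul h) // -(ul k) //.
by case.
Qed.

(** The data of a cofibration [A + A -> Cyl] followed by a weak equivalence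
    [Cyl -> A].  The cofibration enters only through its lifting property, so
    that no coproduct has to be chosen; the inclusions are acyclic cofibrations
    when [A] is cofibrant. *)
Record is_cylinder (A Cyl : C) (i0 i1 : Hom A Cyl) (s : Hom Cyl A) : Prop := {
  cyl_s0 : s ∘ i0 = idm A;
  cyl_s1 : s ∘ i1 = idm A;
  cyl_s : weq M s;
  cyl_i0 : acyclic_cof M i0;
  cyl_i1 : acyclic_cof M i1;
  cyl_lift : forall x y (p : Hom x y) (u0 u1 : Hom A x) (v : Hom Cyl y),
    acyclic_fib M p -> p ∘ u0 = v ∘ i0 -> p ∘ u1 = v ∘ i1 ->
    exists h : Hom Cyl x, h ∘ i0 = u0 /\ h ∘ i1 = u1 /\ p ∘ h = v }.

(** Dually, [X -> P] is a weak equivalence and [P -> X * X] a fibration, which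
    enters through its lifting property. *)
Record is_path_object (X P : C) (c : Hom X P) (p0 p1 : Hom P X) : Prop := {
  path_c0 : p0 ∘ c = idm X;
  path_c1 : p1 ∘ c = idm X;
  path_p0 : acyclic_fib M p0;
  path_lift : forall a b (i : Hom a b) (u : Hom a P) (v0 v1 : Hom b X),
    acyclic_cof M i -> p0 ∘ u = v0 ∘ i -> p1 ∘ u = v1 ∘ i ->
    exists h : Hom b P, h ∘ i = u /\ p0 ∘ h = v0 /\ p1 ∘ h = v1 }.

(** To lift against [u], use the given map on [A] and, on [B], a lift that
    exists because [B] is cofibrant. *)
Lemma coproduct_injections_cof (A B P : C) (u : Hom A P) (v : Hom B P) :
  (forall X (f : Hom A X) (g : Hom B X),
     exists h : Hom P X, h ∘ u = f /\ h ∘ v = g) ->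
  (forall X (h k : Hom P X), h ∘ u = k ∘ u -> h ∘ v = k ∘ v -> h = k) ->
  (cofibrant M B -> cof M u) /\ (cofibrant M A -> cof M v).
Proof.
move=> ex un; split=> hc; apply: cof_of_lifting => x y p hp f g sq.
  have [b pb] := cofibrant_lift (g ∘ v) hc hp.
  have [h [hu hv]] := ex _ f b; exists h; split=> //.
  by apply: un; rewrite -comp_assoc ?hu ?hv.
have [b pb] := cofibrant_lift (g ∘ u) hc hp.
have [h [hu hv]] := ex _ b f; exists h; split=> //.
by apply: un; rewrite -comp_assoc ?hu ?hv.
Qed.

Lemma cylinder_ex (A : C) : cofibrant M A ->
  exists Cyl (i0 i1 : Hom A Cyl) (s : Hom Cyl A), is_cylinder i0 i1 s.
Proof.
move=> cA; have [P [u [v [ex un]]]] := binary_coproduct M A A.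
have [fold [fu fv]] := ex _ (idm A) (idm A).
have [Cyl [k [s [fsk [ck [fs ws]]]]]] := factor_cof_acfib M fold.
have [cu cv] := coproduct_injections_cof ex un.
have s0 : s ∘ (k ∘ u) = idm A by rewrite comp_assoc -fsk.
have s1 : s ∘ (k ∘ v) = idm A by rewrite comp_assoc -fsk.
exists Cyl, (k ∘ u), (k ∘ v), s; split=> //.
- split; first by apply: cof_comp ck (cu cA).
  by apply: (weq_cancel_l ws); rewrite s0; apply: weq_id.
- split; first by apply: cof_comp ck (cv cA).
  by apply: (weq_cancel_l ws); rewrite s1; apply: weq_id.
- move=> x y p u0 u1 w [fp wp] e0 e1.
  have [m [mu mv]] := ex _ u0 u1.
  have [|h [hk ph]] := lift_cof_acfib ck fp wp (u := m) (v := w).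
    by apply: un; rewrite -!comp_assoc ?mu ?mv.
  by exists h; rewrite !comp_assoc hk.
Qed.

Lemma path_object_ex (X : C) : fibrant M X ->
  exists P (c : Hom X P) (p0 p1 : Hom P X), is_path_object c p0 p1.
Proof.
move=> [T [t [hT ft]]]; have [Q [u [v [ex un]]]] := binary_product X X.
have [diag [du dv]] := ex _ (idm X) (idm X).
have [P [c [k [dkc [cc [wc fk]]]]]] := factor_accof_fib M diag.
have c0 : u ∘ k ∘ c = idm X by rewrite -comp_assoc -dkc.
have c1 : v ∘ k ∘ c = idm X by rewrite -comp_assoc -dkc.
exists P, c, (u ∘ k), (v ∘ k); split=> //.
- split; last by apply: (weq_cancel_r wc); rewrite c0; apply: weq_id.
  apply: fib_comp => //; apply: fib_of_lifting => a b i [ci wi] f g sq.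
  have [|h [hi _]] := lift_accof_fib ci wi ft (u := v ∘ f) (v := t ∘ g).
    exact: terminal_eq.
  have [l [lu lv]] := ex _ g h; exists l; split=> //.
  by apply: un; rewrite comp_assoc ?lu ?lv.
- move=> a b i w v0 v1 [ci wi] e0 e1.
  have [m [mu mv]] := ex _ v0 v1.
  have [|h [hi kh]] := lift_accof_fib ci wi fk (u := w) (v := m).
    by apply: un; rewrite !comp_assoc ?mu ?mv.
  by exists h; rewrite -!comp_assoc kh.
Qed.

(** The cylinder is kept fixed, so that one with good lifting properties can be
    used throughout; [left_homotopic] allows an arbitrary one. *)
Definition cylinder_homotopic (A Cyl X : C) (i0 i1 : Hom A Cyl)
  (f g : Hom A X) : Prop := exists H : Hom Cyl X, H ∘ i0 = f /\ H ∘ i1 = g.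

Lemma cylinder_homotopic_postcomp (A Cyl X Y : C) (i0 i1 : Hom A Cyl)
  (f g : Hom A X) (h : Hom X Y) :
  cylinder_homotopic i0 i1 f g -> cylinder_homotopic i0 i1 (h ∘ f) (h ∘ g).
Proof. by move=> [H [<- <-]]; exists (h ∘ H); rewrite -!comp_assoc. Qed.

Lemma cylinder_homotopic_gamma (A Cyl X : C) (i0 i1 : Hom A Cyl)
  (s : Hom Cyl A) (f g : Hom A X) : is_cylinder i0 i1 s ->
  cylinder_homotopic i0 i1 f g -> fmap (gamma M) f = fmap (gamma M) g.
Proof.
move=> [s0 s1 ws _ _ _] [H [H0 H1]]; apply: gamma_left_homotopic.
by exists Cyl, i0, i1, s, H.
Qed.

Section FixedCylinder.
Variables (A Cyl : C) (i0 i1 : Hom A Cyl) (s : Hom Cyl A).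
Hypothesis hCyl : is_cylinder i0 i1 s.

(** Lift the pair of maps [c ∘ p0 ∘ K] and [K] from the two ends of the
    cylinder against the acyclic fibration [p0], over the constant homotopy at
    [p0 ∘ K]; then compose the lift with [p1]. *)
Lemma cylinder_of_path_homotopy (X P : C) (c : Hom X P) (p0 p1 : Hom P X)
  (K : Hom A P) :
  is_path_object c p0 p1 -> cylinder_homotopic i0 i1 (p0 ∘ K) (p1 ∘ K).
Proof.
move=> hP.
have [||G [G0 [G1 _]]] := cyl_lift hCyl (u0 := c ∘ (p0 ∘ K)) (u1 := K)
  (v := p0 ∘ K ∘ s) (path_p0 hP).
- by rewrite comp_assoc (path_c0 hP) comp_idl -comp_assoc (cyl_s0 hCyl) comp_idr.
- by rewrite -comp_assoc (cyl_s1 hCyl) comp_idr.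
exists (p1 ∘ G); rewrite -!comp_assoc G0 G1; split=> //.
by rewrite comp_assoc (path_c1 hP) comp_idl.
Qed.

(** Lift along the first end of the cylinder, over the pair formed by the
    homotopy and the constant homotopy at [f], and restrict to the other end.
    The order of the pair reverses the direction of the homotopy. *)
Lemma path_of_cylinder_homotopy (X P : C) (c : Hom X P) (p0 p1 : Hom P X)
  (f g : Hom A X) :
  is_path_object c p0 p1 -> cylinder_homotopic i0 i1 f g ->
  exists K : Hom A P, p0 ∘ K = g /\ p1 ∘ K = f.
Proof.
move=> hP [H [H0 H1]].
have [||G [G0 [pG0 pG1]]] := path_lift hP (i := i0) (u := c ∘ f) (v0 := H)
  (v1 := f ∘ s) (cyl_i0 hCyl).
- by rewrite comp_assoc (path_c0 hP) comp_idl.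
- by rewrite comp_assoc (path_c1 hP) comp_idl -comp_assoc (cyl_s0 hCyl) comp_idr.
exists (G ∘ i1); rewrite !comp_assoc pG0 pG1; split=> //.
by rewrite -comp_assoc (cyl_s1 hCyl) comp_idr.
Qed.

(** Symmetry comes from passing to a path object, which reverses the direction,
    and back.  For transitivity, a homotopy [f ~ g] on the cylinder and a
    homotopy [g ~ h] in the path object [P] are glued by one lift to a map from
    the cylinder to [P], extending the second homotopy from the end where both
    are at [g]; at the other end it is a homotopy [f ~ h]. *)
Lemma cylinder_homotopic_equiv (X : C) : fibrant M X ->
  equivalence _ (@cylinder_homotopic A Cyl X i0 i1).
Proof.
move=> fX; have [P [c [p0 [p1 hP]]]] := path_object_ex fX.
have symm : symmetric _ (@cylinder_homotopic A Cyl X i0 i1).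
  move=> f g /(path_of_cylinder_homotopy hP) [K [<- <-]].
  exact: cylinder_of_path_homotopy hP.
split=> //.
  move=> f; exists (f ∘ s).
  by rewrite -!comp_assoc (cyl_s0 hCyl) (cyl_s1 hCyl) comp_idr.
move=> f g h [H [H0 H1]] /symm /(path_of_cylinder_homotopy hP) [K [K0 K1]].
have [||G [G1 [pG0 pG1]]] := path_lift hP (i := i1) (u := K) (v0 := H)
  (v1 := h ∘ s) (cyl_i1 hCyl).
- by rewrite K0.
- by rewrite K1 -comp_assoc (cyl_s1 hCyl) comp_idr.
have <- : p0 ∘ (G ∘ i0) = f by rewrite comp_assoc pG0.
have <- : p1 ∘ (G ∘ i0) = h.
  by rewrite comp_assoc pG1 -comp_assoc (cyl_s0 hCyl) comp_idr.
exact: cylinder_of_path_homotopy hP.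
Qed.

(** Two extensions along an acyclic cofibration are joined by a homotopy in a
    path object of the target. *)
Lemma extension_unique (X X' Y : C) (q : Hom X X') (t t' : Hom X' Y)
  (a : Hom A X') :
  fibrant M Y -> acyclic_cof M q -> t ∘ q = t' ∘ q ->
  cylinder_homotopic i0 i1 (t ∘ a) (t' ∘ a).
Proof.
move=> fY hq e; have [P [c [p0 [p1 hP]]]] := path_object_ex fY.
have [||G [_ [<- <-]]] := path_lift hP (i := q) (u := c ∘ (t ∘ q)) (v0 := t)
  (v1 := t') hq.
- by rewrite comp_assoc (path_c0 hP) comp_idl.
- by rewrite comp_assoc (path_c1 hP) comp_idl.
rewrite -!comp_assoc; exact: cylinder_of_path_homotopy hP.
Qed.

End FixedCylinder.
End Basics.

(** * Morphisms in the homotopy category as homotopy classes *)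

(** Isomorphisms require an inverse function, while bijectivity of the action
    of a weak equivalence is all that lifting arguments give. *)
Lemma bijection_inverse (X Y : Type) (f : X -> Y) :
  (forall x x', f x = f x' -> x = x') -> (forall y, exists x, f x = y) ->
  exists g : Y -> X, (forall x, g (f x) = x) /\ (forall y, f (g y) = y).
Proof.
move=> inj surj.
pose g y := proj1_sig (constructive_indefinite_description _ (surj y)).
have fg y : f (g y) = y.
  by rewrite /g; case: constructive_indefinite_description.
by exists g; split=> // x; apply: inj.
Qed.

Section HomotopyClasses.
Variables (C : Category) (M : ModelStructure C).
Variables (A Cyl : C) (i0 i1 : Hom A Cyl) (s : Hom Cyl A).
Hypotheses (cA : cofibrant M A) (hCyl : is_cylinder M i0 i1 s).

Variables (R : C -> C) (q : forall X, Hom X (R X)).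
Hypotheses (hq : forall X, acyclic_cof M (q X)) (fR : forall X, fibrant M (R X)).

Definition ho_classes (X : C) : Type := quot (@cylinder_homotopic C A Cyl X i0 i1).

Definition ho_class (X : C) (f : Hom A X) : ho_classes X := class _ f.

Lemma ho_class_eq (X : C) (f g : Hom A X) : fibrant M X ->
  ho_class f = ho_class g <-> cylinder_homotopic i0 i1 f g.
Proof.
move=> fX; split; first exact: class_inj (cylinder_homotopic_equiv hCyl fX) _ _.
exact: class_eq (cylinder_homotopic_equiv hCyl fX) _ _.
Qed.

Lemma replacement_extend_ex (X Y : C) (f : Hom X Y) :
  exists f' : Hom (R X) (R Y), f' ∘ q X = q Y ∘ f.
Proof. by have [cq wq] := hq X; apply: fibrant_extend. Qed.

Definition replacement_extend (X Y : C) (f : Hom X Y) : Hom (R X) (R Y) :=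
  proj1_sig (constructive_indefinite_description _ (replacement_extend_ex f)).

Lemma replacement_extend_comm (X Y : C) (f : Hom X Y) :
  replacement_extend f ∘ q X = q Y ∘ f.
Proof.
by rewrite /replacement_extend; case: constructive_indefinite_description.
Qed.

Definition ho_classes_map (X Y : C) (f : Hom X Y) (t : ho_classes (R X)) :
  ho_classes (R Y) := ho_class (replacement_extend f ∘ repr t).

Lemma ho_classes_mapE (X Y : C) (f : Hom X Y) (f' : Hom (R X) (R Y))
  (t : Hom A (R X)) :
  f' ∘ q X = q Y ∘ f -> ho_classes_map f (ho_class t) = ho_class (f' ∘ t).
Proof.
move=> e; transitivity (ho_class (replacement_extend f ∘ t)).
  apply/ho_class_eq => //; apply: cylinder_homotopic_postcomp.
  exact: repr_class (cylinder_homotopic_equiv hCyl (fR X)) t.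
apply/ho_class_eq => //; apply: (extension_unique hCyl t (fR Y) (hq X)).
by rewrite replacement_extend_comm.
Qed.

(** The target of the functor of homotopy classes: the category of sets would
    do, but using the objects of [C] as names for the sets keeps the objects in
    the universe of [C]. *)
Definition ho_classes_cat : Category.
Proof.
refine {| Ob := C; Hom := fun X Y => ho_classes (R X) -> ho_classes (R Y);
  idm := fun X t => t; comp := fun X Y Z g f t => g (f t) |} => //.
Defined.

Program Definition ho_classes_functor : Functor C ho_classes_cat :=
  {| fob := fun X => X : ho_classes_cat; fmap := ho_classes_map |}.
Next Obligation.
move=> X; apply: functional_extensionality => t.
rewrite -{1}(class_repr t) (@ho_classes_mapE _ _ _ (idm _)).
  by rewrite comp_idl comp_idr.
rewrite comp_idl; exact: class_repr.
Qed.
Next Obligation.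
move=> X Y Z g f; apply: functional_extensionality => t.
rewrite -(class_repr t).
rewrite (@ho_classes_mapE _ _ _ (replacement_extend g ∘ replacement_extend f)).
  rewrite -comp_assoc replacement_extend_comm comp_assoc.
  by rewrite replacement_extend_comm comp_assoc.
rewrite /= (@ho_classes_mapE _ _ _ _ _ (replacement_extend_comm f)).
by rewrite (@ho_classes_mapE _ _ _ _ _ (replacement_extend_comm g)) comp_assoc.
Qed.

(** A weak equivalence between fibrant objects factors as an acyclic cofibration
    [j] and an acyclic fibration [p].  Maps and homotopies lift through [p], and
    [j] has a retraction [r] with [j ∘ r] homotopic to the identity. *)
Lemma ho_classes_functor_weq (X Y : C) (w : Hom X Y) : weq M w ->
  is_iso (fmap ho_classes_functor w).
Proof.
move=> ww; have ew := replacement_extend_comm w; move: (replacement_extend w) ew.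
move=> w' ew.
have ww' : weq M w'.
  have [_ wX] := hq X; have [_ wY] := hq Y.
  by apply: (weq_cancel_r wX); rewrite ew; apply: weq_comp.
have [Z [j [p [wpj [cj [wj fp]]]]]] := factor_accof_fib M w'.
have hp : acyclic_fib M p.
  by split=> //; apply: (weq_cancel_r wj); rewrite -wpj.
have fZ : fibrant M Z := fibrant_fib (fR Y) fp.
have [r rj] := fibrant_extend (idm (R X)) (fR X) cj wj.
have [||g [gf fg]] := @bijection_inverse _ _ (ho_classes_map w).
- move=> t t'; rewrite -(class_repr t) -(class_repr t').
  rewrite !(@ho_classes_mapE _ _ _ _ _ ew) => /(ho_class_eq _ _ (fR Y)) [H [H0 H1]].
  have [||G [G0 [G1 _]]] := cyl_lift hCyl (p := p) (u0 := j ∘ repr t)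
    (u1 := j ∘ repr t') (v := H) hp.
  - by rewrite comp_assoc -wpj.
  - by rewrite comp_assoc -wpj.
  apply/ho_class_eq => //; exists (r ∘ G).
  by rewrite -!comp_assoc G0 G1 !comp_assoc rj !comp_idl.
- move=> u; have [u' pu'] := cofibrant_lift (repr u) cA hp.
  exists (ho_class (r ∘ u')); rewrite (ho_classes_mapE _ ew) -[RHS]class_repr.
  apply/ho_class_eq => //.
  rewrite -pu' wpj -(comp_assoc p); apply: cylinder_homotopic_postcomp.
  rewrite comp_assoc -{2}(comp_idl u').
  apply: (extension_unique hCyl u' fZ (conj cj wj)).
  by rewrite -comp_assoc rj comp_idl comp_idr.
exists g; split; apply: functional_extensionality => t; [exact: gf|exact: fg].
Qed.

Definition ho_classes_action : Functor (Ho M) ho_classes_cat :=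
  loc_lift ho_classes_functor_weq.

Lemma ho_classes_actionE (X Y : C) (f : Hom X Y) (t : ho_classes (R X)) :
  fmap ho_classes_action (fmap (gamma M) f) t = ho_classes_map f t.
Proof.
rewrite /= (leval_eq ho_classes_functor_weq
  (repr_class (lmor_equiv (@weq C M) X Y) (lm_of f))).
by [].
Qed.

(** The naturality half of the Yoneda argument.  The homotopy category acts on
    the morphisms [x] from [A] and on the homotopy classes of [t]; the relation
    [q X ∘ x = t] between them is preserved by morphisms of [C], and this passes
    to composites and inverses. *)
Lemma ho_classes_classify (X Y : C) (p : Hom (gamma M X) (gamma M Y))
  (x : Hom (gamma M A) (gamma M X)) (t : Hom A (R X)) (t' : Hom A (R Y)) :
  fmap (gamma M) (q X) ∘ x = fmap (gamma M) t ->
  fmap ho_classes_action p (ho_class t) = ho_class t' ->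
  fmap (gamma M) (q Y) ∘ (p ∘ x) = fmap (gamma M) t'.
Proof.
have q_iso Z : is_iso (fmap (gamma M) (q Z)).
  by have [_ wq] := hq Z; apply: gamma_weq_iso.
have ho_classE Z (u u' : Hom A (R Z)) : ho_class u = ho_class u' ->
    fmap (gamma M) u = fmap (gamma M) u'.
  by move=> /(ho_class_eq _ _ (fR Z)) /(cylinder_homotopic_gamma hCyl).
pose P (X Y : C) (p : @Hom (Ho M) X Y) := forall (x : @Hom (Ho M) A X)
  (t : Hom A (R X)) (t' : Hom A (R Y)),
  fmap (gamma M) (q X) ∘ x = fmap (gamma M) t ->
  fmap ho_classes_action p (ho_class t) = ho_class t' ->
  fmap (gamma M) (q Y) ∘ (p ∘ x) = fmap (gamma M) t'.
apply: (@loc_ind C (@weq C M) P) => {X Y p x t t'}.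
- move=> X Y f x t t' e.
  rewrite ho_classes_actionE (ho_classes_mapE _ (replacement_extend_comm f)).
  move=> /ho_classE <-; rewrite fmap_comp -e !comp_assoc -!fmap_comp.
  by rewrite replacement_extend_comm fmap_comp.
- move=> X Y Z p' p Pp' Pp x t t' e.
  have et : fmap ho_classes_action p (ho_class t)
    = ho_class (repr (fmap ho_classes_action p (ho_class t))).
    by symmetry; apply: class_repr.
  have -> : fmap ho_classes_action (p' ∘ p) (ho_class t)
    = fmap ho_classes_action p' (fmap ho_classes_action p (ho_class t)).
    by rewrite fmap_comp.
  rewrite {}et -comp_assoc; apply: Pp'; apply: Pp e _.
  by symmetry; apply: class_repr.
- move=> X Y p p' p'p pp' Pp x t t' e e'.
  have [q' [q'q qq']] := q_iso X.
  have e1 : fmap ho_classes_action p (ho_class t') = ho_class t.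
    have := fmap_comp ho_classes_action p p'; rewrite pp' fmap_id.
    by move=> /(f_equal (fun h => h (ho_class t))) /= ->; rewrite -e'.
  have := Pp (q' ∘ fmap (gamma M) t') t' t.
  rewrite comp_assoc qq' comp_idl => /(_ eq_refl e1).
  rewrite -e => /(is_iso_mono (q_iso Y)) <-.
  by rewrite (comp_assoc p') p'p comp_idl comp_assoc qq' comp_idl.
Qed.

End HomotopyClasses.

Section Saturation.
Variables (C : Category) (M : ModelStructure C).

Lemma fibrant_replacements : exists (R : C -> C) (q : forall X, Hom X (R X)),
  (forall X, acyclic_cof M (q X)) /\ (forall X, fibrant M (R X)).
Proof.
pose r X := constructive_indefinite_description _ (fibrant_approximation M X).
have rP X : exists q : Hom X (proj1_sig (r X)),
    acyclic_cof M q /\ fibrant M (proj1_sig (r X)).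
  by case: (r X).
pose q X := constructive_indefinite_description _ (rP X).
exists (fun X => proj1_sig (r X)), (fun X => proj1_sig (q X)).
by split=> X; case: (q X) => ? [].
Qed.

Lemma fibrant_retraction (X Y : C) (q : Hom X Y) : fibrant M X ->
  acyclic_cof M q -> exists r : Hom Y X, r ∘ q = idm X.
Proof. by move=> fX [cq wq]; exact: fibrant_extend fX cq wq. Qed.

(** Apply the classification to [x = id] and [t = q A]: the morphism [q X ∘ a]
    is the image of a map [t : A -> R X], and [X] is a retract of [R X]. *)
Lemma gamma_full (A X : C) (a : Hom (gamma M A) (gamma M X)) :
  cofibrant M A -> fibrant M X -> exists f : Hom A X, fmap (gamma M) f = a.
Proof.
move=> cA fX; have [Cyl [i0 [i1 [s hCyl]]]] := cylinder_ex cA.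
have [R [q [hq fR]]] := fibrant_replacements.
have [r rq] := fibrant_retraction fX (hq X).
pose E := ho_classes_action cA hCyl hq fR.
pose t := repr (fmap E a (ho_class i0 i1 (q A))).
have et : fmap E a (ho_class i0 i1 (q A)) = ho_class i0 i1 t.
  by symmetry; apply: class_repr.
have qa : fmap (gamma M) (q X) ∘ (a ∘ idm _) = fmap (gamma M) t.
  by apply: (ho_classes_classify _ et); apply: comp_idr.
exists (r ∘ t); rewrite fmap_comp -qa comp_idr comp_assoc -fmap_comp rq.
by rewrite fmap_id comp_idl.
Qed.

(** Equal morphisms act in the same way on the class of [q A], so [q X ∘ f] and
    [q X ∘ g] are homotopic; compose with a retraction of [q X]. *)
Lemma gamma_faithful (A Cyl X : C) (i0 i1 : Hom A Cyl) (s : Hom Cyl A)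
  (f g : Hom A X) :
  cofibrant M A -> fibrant M X -> is_cylinder M i0 i1 s ->
  fmap (gamma M) f = fmap (gamma M) g -> cylinder_homotopic i0 i1 f g.
Proof.
move=> cA fX hCyl e.
have [R [q [hq fR]]] := fibrant_replacements.
have [r rq] := fibrant_retraction fX (hq X).
have := @ho_classes_actionE _ _ _ _ _ _ _ cA hCyl _ _ hq fR _ _ f
  (ho_class i0 i1 (q A)).
rewrite e ho_classes_actionE.
rewrite !(ho_classes_mapE hCyl hq fR _ (replacement_extend_comm hq fR _)).
rewrite !replacement_extend_comm => /(ho_class_eq hCyl _ _ (fR X)).
move=> /(cylinder_homotopic_postcomp r).
rewrite !comp_assoc rq !comp_idl.
by have [_ _ symm] := cylinder_homotopic_equiv hCyl fX; apply: symm.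
Qed.

Lemma homotopic_to_weq (A Cyl X : C) (i0 i1 : Hom A Cyl) (s : Hom Cyl A)
  (f g : Hom A X) :
  is_cylinder M i0 i1 s -> cylinder_homotopic i0 i1 f g -> weq M g -> weq M f.
Proof.
move=> hCyl [H [<- <-]] wH.
have [_ w0] := cyl_i0 hCyl; have [_ w1] := cyl_i1 hCyl.
by apply: weq_comp => //; apply: weq_cancel_r w1 wH.
Qed.

(** A right inverse of [p] up to homotopy can be deformed into a section [s] by
    lifting the homotopy.  Then [s ∘ p] is homotopic to the identity, hence a
    weak equivalence, and [p] is a retract of [s ∘ p]. *)
Lemma weq_of_iso_fib (X Y : C) (p : Hom X Y) :
  bifibrant M X -> bifibrant M Y -> fib M p -> is_iso (fmap (gamma M) p) ->
  weq M p.
Proof.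
move=> [fX cX] [fY cY] fp ip; have [p' [p'p pp']] := ip.
have [s0 es0] := gamma_full p' cY fX.
have [CY [i0 [i1 [sY hCY]]]] := cylinder_ex cY.
have [|H [H0 H1]] := @gamma_faithful _ _ _ i0 i1 sY (p ∘ s0) (idm Y) cY fY hCY.
  by rewrite fmap_comp es0 pp' fmap_id.
have [c0 w0] := cyl_i0 hCY.
have [|G [G0 pG]] := lift_accof_fib c0 w0 fp (u := s0) (v := H).
  by rewrite H0.
have [s ps] : exists s, p ∘ s = idm Y by exists (G ∘ i1); rewrite comp_assoc pG.
have [CX [j0 [j1 [sX hCX]]]] := cylinder_ex cX.
(* [p ∘ s ∘ p = p], and [p] can be cancelled in the homotopy category. *)
have wsp : weq M (s ∘ p).
  apply: (homotopic_to_weq hCX (g := idm X)); last exact: weq_id.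
  apply: gamma_faithful hCX _ => //.
  apply: (is_iso_mono ip); rewrite -fmap_comp comp_assoc ps comp_idl.
  by rewrite fmap_id comp_idr.
apply: weq_retract wsp; exists (idm X), (idm X), s, p.
by rewrite comp_assoc ps !comp_idl !comp_idr.
Qed.

Lemma weq_of_iso_bifibrant (X Y : C) (f : Hom X Y) :
  bifibrant M X -> bifibrant M Y -> is_iso (fmap (gamma M) f) -> weq M f.
Proof.
move=> [fX cX] [fY cY]; have [Z [j [p [-> [cj [wj fp]]]]]] := factor_accof_fib M f.
rewrite fmap_comp => /(is_iso_cancel_r (gamma_weq_iso wj)) ip.
apply: weq_comp => //; apply: weq_of_iso_fib => //.
by split; [apply: fibrant_fib fp|apply: cofibrant_cof cj].
Qed.

(** Saturation: after cofibrant and then fibrant replacement of source and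
    target, and a factorisation, one is reduced to [weq_of_iso_fib]. *)
Theorem weq_of_iso (X Y : C) (f : Hom X Y) :
  is_iso (fmap (gamma M) f) -> weq M f.
Proof.
move=> iso_f.
have [X1 [p [[fp wp] cX1]]] := cofibrant_approximation M X.
have [Y1 [p' [hp' cY1]]] := cofibrant_approximation M Y.
have [f1 ef1] := cofibrant_lift (f ∘ p) cX1 hp'.
have [X2 [q [[cq wq] fX2]]] := fibrant_approximation M X1.
have [Y2 [q' [[cq' wq'] fY2]]] := fibrant_approximation M Y1.
have [f2 ef2] := fibrant_extend (q' ∘ f1) fY2 cq wq.
have [fp' wp'] := hp'.
have iso_f1 : is_iso (fmap (gamma M) f1).
  apply: (is_iso_cancel_l (gamma_weq_iso wp')); rewrite -fmap_comp ef1 fmap_comp.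
  by apply: is_iso_comp => //; apply: gamma_weq_iso.
have wf2 : weq M f2.
  apply: weq_of_iso_bifibrant.
  - by split=> //; apply: cofibrant_cof cq.
  - by split=> //; apply: cofibrant_cof cq'.
  apply: (is_iso_cancel_r (gamma_weq_iso wq)); rewrite -fmap_comp ef2 fmap_comp.
  by apply: is_iso_comp => //; apply: gamma_weq_iso.
have wf1 : weq M f1.
  by apply: (weq_cancel_l wq'); rewrite -ef2; apply: weq_comp.
by apply: (weq_cancel_r wp); rewrite -ef1; apply: weq_comp.
Qed.

End Saturation.

(** * Universal arrows and adjunctions *)

Definition universal_arrow (C D : Category) (U : Functor D C) (x : C) (y : D)
  (g : Hom x (U y)) : Prop :=
  forall z (a : Hom x (U z)), exists! h : Hom y z, fmap U h ∘ g = a.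

Lemma universal_arrow_precomp (C D : Category) (U : Functor D C) (x x' : C)
  (y : D) (g : Hom x (U y)) (k : Hom x' x) :
  is_iso k -> universal_arrow g <-> universal_arrow (g ∘ k).
Proof.
move=> ik; have [k' [k'k kk']] := ik; split=> hg z a.
  have [h [hh uh]] := hg z (a ∘ k'); exists h; split.
    by rewrite comp_assoc hh -comp_assoc k'k comp_idr.
  move=> h' eh'; apply: uh; apply: (is_iso_epi ik).
  by rewrite -comp_assoc eh' -comp_assoc k'k comp_idr.
have [h [hh uh]] := hg z (a ∘ k); exists h; split.
  by apply: (is_iso_epi ik); rewrite -comp_assoc.
by move=> h' eh'; apply: uh; rewrite comp_assoc eh'.
Qed.

(** Both are initial among the arrows [x -> U z], so the comparison between two
    universal arrows is invertible. *)
Lemma universal_arrow_postcomp (C D : Category) (U : Functor D C) (x : C)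
  (y y' : D) (g : Hom x (U y)) (k : Hom y y') :
  universal_arrow g -> is_iso k <-> universal_arrow (fmap U k ∘ g).
Proof.
move=> hg; split.
  move=> ik z a; have [k' [k'k kk']] := ik; have [h [hh uh]] := hg z a.
  exists (h ∘ k'); split.
    by rewrite comp_assoc -fmap_comp -comp_assoc k'k comp_idr.
  move=> h' eh'; apply: (is_iso_epi ik); rewrite -comp_assoc k'k comp_idr.
  by apply: uh; rewrite fmap_comp -comp_assoc.
move=> hkg; have [l [hl _]] := hkg y g.
exists l; split.
  have [h [_ uh]] := hg y g.
  rewrite -(uh (l ∘ k)); first by rewrite fmap_comp -comp_assoc.
  by apply: uh; rewrite fmap_id comp_idl.
have [h [_ uh]] := hkg y' (fmap U k ∘ g).
rewrite -(uh (k ∘ l)); first by rewrite fmap_comp -comp_assoc hl.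
by apply: uh; rewrite fmap_id comp_idl.
Qed.

Lemma unit_universal (C D : Category) (F : Functor C D) (U : Functor D C)
  (a : Adjunction F U) (x : C) : universal_arrow (flat_of a (idm (F x))).
Proof.
move=> z b; exists (sharp_of a b); split.
  by rewrite -flat_natr comp_idr flat_sharp.
by move=> h <-; rewrite -flat_natr comp_idr sharp_flat.
Qed.

(** The unit is universal, and [g] is the composite of the unit with [U] of its
    adjoint. *)
Lemma sharp_iso_universal (C D : Category) (F : Functor C D) (U : Functor D C)
  (a : Adjunction F U) (x : C) (y : D) (g : Hom x (U y)) :
  is_iso (sharp_of a g) <-> universal_arrow g.
Proof.
rewrite (universal_arrow_postcomp _ (@unit_universal _ _ _ _ a x)).
by rewrite -flat_natr comp_idr flat_sharp.
Qed.

Lemma sharp_natr (C D : Category) (F : Functor C D) (U : Functor D C)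
  (a : Adjunction F U) (x : C) (y y' : D) (g : Hom x (U y)) (k : Hom y y') :
  sharp_of a (fmap U k ∘ g) = k ∘ sharp_of a g.
Proof. by apply: (@flat_inj _ _ _ _ a); rewrite flat_natr !flat_sharp. Qed.

Lemma sharp_natl (C D : Category) (F : Functor C D) (U : Functor D C)
  (a : Adjunction F U) (x x' : C) (y : D) (g : Hom x (U y)) (k : Hom x' x) :
  sharp_of a (g ∘ k) = sharp_of a g ∘ fmap F k.
Proof. by apply: (@flat_inj _ _ _ _ a); rewrite flat_natl !flat_sharp. Qed.

(** * Quillen pairs *)

Section QuillenPair.
Variables (C D : Category) (MC : ModelStructure C) (MD : ModelStructure D).
Variables (F : Functor C D) (U : Functor D C) (adj : Adjunction F U).
Hypothesis F_cof : forall x y (f : @Hom C x y), cof MC f -> cof MD (fmap F f).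
Hypothesis F_accof : forall x y (f : @Hom C x y),
  acyclic_cof MC f -> acyclic_cof MD (fmap F f).

Lemma left_adjoint_cofibrant (X : C) : cofibrant MC X -> cofibrant MD (F X).
Proof.
move=> [T [t [hT ct]]]; exists (F T), (fmap F t); split; last exact: F_cof.
move=> Z; have [f [_ uf]] := hT (U Z).
exists (sharp_of adj f); split=> // g _.
by rewrite -(sharp_flat adj g) (uf (flat_of adj g)).
Qed.

(** Ken Brown's lemma.  Factor [(l, id) : A + B -> B] as a cofibration followed
    by an acyclic fibration [r : Z -> B].  The two maps to [Z] are acyclic
    cofibrations, and [F r] is a weak equivalence since [r] has one of them as
    a section. *)
Lemma left_quillen_weq (A B : C) (l : Hom A B) :
  cofibrant MC A -> cofibrant MC B -> weq MC l -> weq MD (fmap F l).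
Proof.
move=> cA cB wl; have [P [u [v [ex un]]]] := binary_coproduct MC A B.
have [m [mu mv]] := ex _ l (idm B).
have [Z [k [r [mrk [ck [fr wr]]]]]] := factor_cof_acfib MC m.
have [cu cv] := coproduct_injections_cof MC ex un.
have rku : r ∘ (k ∘ u) = l by rewrite comp_assoc -mrk.
have rkv : r ∘ (k ∘ v) = idm B by rewrite comp_assoc -mrk.
have [|_ wFu] := F_accof (f := k ∘ u).
  split; first by apply: cof_comp ck (cu cB).
  by apply: (weq_cancel_l wr); rewrite rku.
have [|_ wFv] := F_accof (f := k ∘ v).
  split; first by apply: cof_comp ck (cv cA).
  by apply: (weq_cancel_l wr); rewrite rkv; apply: weq_id.
rewrite -rku fmap_comp; apply: weq_comp => //; apply: (weq_cancel_r wFv).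
by rewrite -fmap_comp rkv fmap_id; apply: weq_id.
Qed.

(** Both approximations of [X] factor through one that is an acyclic fibration,
    by weak equivalences of cofibrant objects, which [F] preserves. *)
Lemma sharp_weq_approximation (A A' X : C) (Z : D) (p : Hom A X) (p' : Hom A' X)
  (g : Hom X (U Z)) :
  cofibrant MC A -> cofibrant MC A' -> weq MC p -> weq MC p' ->
  weq MD (sharp_of adj (g ∘ p)) -> weq MD (sharp_of adj (g ∘ p')).
Proof.
have [B [b [hb cB]]] := cofibrant_approximation MC X; have [fb wb] := hb.
have lift E (e : Hom E X) : cofibrant MC E -> weq MC e ->
    exists l, weq MD (fmap F l) /\
      sharp_of adj (g ∘ e) = sharp_of adj (g ∘ b) ∘ fmap F l.
  move=> cE we; have [l bl] := cofibrant_lift e cE hb; exists l; split.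
    by apply: left_quillen_weq => //; apply: (weq_cancel_l wb); rewrite bl.
  by rewrite -sharp_natl -comp_assoc bl.
move=> cA cA' wp wp'; have [l [wl ->]] := lift _ _ cA wp.
have [l' [wl' ->]] := lift _ _ cA' wp'.
by move=> /(weq_cancel_r wl) wg; apply: weq_comp.
Qed.

(** The right derived functor of [U] on fibrant objects, up to a natural
    isomorphism [eps].  Its target is the whole homotopy category, because the
    cofibrant object [A] below need not be fibrant. *)
Variable R : Functor (Hof MD) (Ho MC).
Variable eps : forall Z : Fibr MD,
  Hom (gamma MC (U (proj1_sig Z))) (R (gamma_f MD Z)).
Hypothesis eps_iso : forall Z, is_iso (eps Z).
Hypothesis eps_nat : forall (Z W : Fibr MD) (f : Hom Z W),
  fmap R (fmap (gamma_f MD) f) ∘ eps Z = eps W ∘ fmap (gamma MC) (fmap U f).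

(** Every morphism from [Z] to a fibrant [W] is the class of some [m], and is
    sent to the class of the adjoint of [m ∘ i].  Existence: every [A -> U W] is
    the adjoint of some [F A -> W], which extends along [i].  Uniqueness: a
    homotopy between adjoints is adjoint to a homotopy on [F Cyl], which is a
    cylinder of [F A] because [F i0] is an acyclic cofibration. *)
Lemma derived_unit_universal (A : C) (Z : Fibr MD) (i : Hom (F A) (proj1_sig Z)) :
  cofibrant MC A -> acyclic_cof MD i ->
  universal_arrow (eps Z ∘ fmap (gamma MC) (flat_of adj i)).
Proof.
move=> cA [ci wi].
have cZ : cofibrant MD (proj1_sig Z).
  exact: cofibrant_cof (left_adjoint_cofibrant cA) ci.
have iE (W : Fibr MD) (m : Hom Z W) :
    fmap R (fmap (gamma_f MD) m) ∘ (eps Z ∘ fmap (gamma MC) (flat_of adj i))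
    = eps W ∘ fmap (gamma MC) (flat_of adj ((m : Hom (proj1_sig Z) _) ∘ i)).
  by rewrite comp_assoc eps_nat -comp_assoc -fmap_comp -flat_natr.
have full (W : Fibr MD) (h : Hom (gamma_f MD Z) (gamma_f MD W)) :
    exists m : Hom Z W, fmap (gamma_f MD) m = h.
  exact: (@gamma_full _ MD _ _ h cZ (proj2_sig W)).
move=> [W fW] a; have [e' [e'e ee']] := eps_iso (exist _ W fW).
have fUW := right_adjoint_fibrant adj F_accof fW.
have [k ek] := gamma_full (e' ∘ a) cA fUW.
have [m mi] := fibrant_extend (sharp_of adj k) fW ci wi.
exists (fmap (gamma_f MD) (m : Hom Z (exist _ W fW : Fibr MD))); split.
  transitivity (eps (exist _ W fW) ∘ fmap (gamma MC) (flat_of adj (m ∘ i))).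
    exact: (iE (exist _ W fW) m).
  by rewrite mi flat_sharp ek comp_assoc ee' comp_idl.
move=> h; have [m' <-] := full (exist _ W fW) h => eh.
have {}eh := eq_trans (eq_sym (iE (exist _ W fW) m')) eh.
have {}eh : fmap (gamma MC) (flat_of adj ((m' : Hom (proj1_sig Z) W) ∘ i))
    = fmap (gamma MC) k.
  by apply: (is_iso_mono (eps_iso (exist _ W fW)));
    rewrite eh ek comp_assoc ee' comp_idl.
have [Cyl [i0 [i1 [s hCyl]]]] := cylinder_ex cA.
have [H [H0 H1]] := gamma_faithful cA fUW hCyl eh.
have E : fmap (gamma MD) ((m' : Hom (proj1_sig Z) W) ∘ i) = fmap (gamma MD) (m ∘ i).
  apply: gamma_left_homotopic.
  exists (F Cyl), (fmap F i0), (fmap F i1), (fmap F s), (sharp_of adj H).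
  rewrite -!fmap_comp -!sharp_natl H0 H1 (cyl_s0 hCyl) (cyl_s1 hCyl) !fmap_id.
  rewrite sharp_flat mi; split=> //; split=> //; split=> //.
  have [_ w0] := F_accof (cyl_i0 hCyl); apply: (weq_cancel_r w0).
  by rewrite -fmap_comp (cyl_s0 hCyl) fmap_id; apply: weq_id.
(* [i] becomes invertible and can be cancelled. *)
rewrite !fmap_comp in E.
by symmetry; apply: (is_iso_epi (gamma_weq_iso wi) E).
Qed.

Lemma derived_universal_iff_weq (A X : C) (Z : Fibr MD) (p : Hom A X)
  (g : Hom X (U (proj1_sig Z))) :
  cofibrant MC A -> weq MC p ->
  universal_arrow (eps Z ∘ fmap (gamma MC) g)
  <-> weq MD (sharp_of adj (g ∘ p)).
Proof.
move=> cA wp.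
(* Replacing [X] by [A] makes the arrow a composite of the derived unit and [k]. *)
rewrite (universal_arrow_precomp _ (gamma_weq_iso wp)) -comp_assoc -fmap_comp.
have [Z' [i [k [eki [ci [wi fk]]]]]] := factor_accof_fib MD (sharp_of adj (g ∘ p)).
have fZ' := fibrant_fib (proj2_sig Z) fk.
have hi := @derived_unit_universal A (exist _ Z' fZ') i cA (conj ci wi).
have -> : eps Z ∘ fmap (gamma MC) (g ∘ p)
  = fmap R (fmap (gamma_f MD) (k : Hom (exist _ Z' fZ' : Fibr MD) Z))
    ∘ (eps (exist _ Z' fZ') ∘ fmap (gamma MC) (flat_of adj i)).
  by rewrite comp_assoc eps_nat -comp_assoc -fmap_comp -flat_natr -eki flat_sharp.
rewrite -(universal_arrow_postcomp _ hi) eki; split.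
  by move=> ik; apply: weq_comp => //; apply: weq_of_iso.
by move=> wki; apply: gamma_weq_iso; apply: weq_cancel_r wi wki.
Qed.

End QuillenPair.

(** * Sheaves *)

Section Sheaves.
Variables (I : Category) (C : I -> Category).
Variables (M : forall i, ModelStructure (C i)).
Variables (B : AdjunctionBundle C) (hB : model_bundle M B).

(** A cofibrant approximation [A -> Y_i] followed by [f_i] is one of [Z_i], and
    the associated map [F A -> Z_j] is [F A -> Y_j] followed by [f_j].  Passing
    to an approximation that is an acyclic fibration is harmless by
    [sharp_weq_approximation]. *)
Lemma left_homotopy_sheaf_weq (Y Z : Tw B) (f : Hom Y Z) : pointwise_weq M f ->
  left_homotopy_sheaf M Y <-> left_homotopy_sheaf M Z.
Proof.
move=> wf.
have fE i j (s : @Hom I i j) (A : C i) (p : Hom A (Y i)) :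
    sharp_of (badj B s) (tflat Z s ∘ (twc f i ∘ p))
    = twc f j ∘ sharp_of (badj B s) (tflat Y s ∘ p).
  by rewrite -sharp_natr !comp_assoc (proj2_sig f i j s).
split=> hs i j s; have [cF accF] := hB s; have [A [p [hp [cA wp]]]] := hs i j s.
  have [A' [p' [hp' cA']]] := cofibrant_approximation (M i) (Z i).
  exists A', p'; split=> //; split=> //; have [_ wp'] := hp'; have [_ wp0] := hp.
  apply: (sharp_weq_approximation accF cA cA' (p := twc f i ∘ p)) => //.
    exact: weq_comp (wf i) wp0.
  by rewrite fE; apply: weq_comp.
have [A' [p' [hp' cA']]] := cofibrant_approximation (M i) (Y i).
exists A', p'; split=> //; split=> //; have [_ wp'] := hp'; have [_ wp0] := hp.
apply: (weq_cancel_l (wf j)); rewrite -fE.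
apply: (sharp_weq_approximation accF cA cA' (p := p)) => //.
exact: weq_comp (wf i) wp'.
Qed.

Variables (rep : forall i, Replacements (M i)) (H : HomotopyBundle rep hB).

(** Each structure map of [Gamma Z] is the class of one of [Z], followed by the
    equality of objects expressing that the derived functor is induced by [U];
    this equality serves as [eps] in [derived_universal_iff_weq]. *)
Lemma Gamma_left_strict_sheaf (Z : FullSub (@pointwise_fibrant I C M B)) :
  left_strict_sheaf (Gamma H Z) <-> left_homotopy_sheaf M (proj1_sig Z).
Proof.
have key i j (s : @Hom I i j) (A : C i) (p : Hom A (proj1_sig Z i)) :
    cofibrant (M i) A -> weq (M i) p ->
    is_iso (tsharp (Gamma H Z) s)
    <-> weq (M j) (sharp_of (badj B s) (tflat (proj1_sig Z) s ∘ p)).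
  move=> cA wp; have [cF accF] := hB s.
  rewrite /tsharp sharp_iso_universal.
  pose R : Functor (Hof (M j)) (Ho (M i)) := full_incl _ ⊚ bU H s.
  pose eps (W : Fibr (M j)) : Hom (gamma (M i) (bU B s (proj1_sig W)))
      (R (gamma_f (M j) W)) :=
    eq_hom (eq_sym (functor_eq_ob (hob_R H s) W)).
  apply: (@derived_universal_iff_weq _ _ (M i) (M j) _ _ (badj B s) cF accF R eps
    _ _ A _ (Gamma_tob Z j) p (tflat (proj1_sig Z) s) cA wp).
  - move=> W.
    have [g [g1 g2]] := is_iso_eq_hom (eq_sym (functor_eq_ob (hob_R H s) W)).
    by exists g.
  - by move=> W W' g; apply: (hob_R_nat H s g).
split=> hs i j s; last first.
  have [A [p [[_ wp] [cA w]]]] := hs i j s.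
  by apply/(key _ _ s A p cA wp).
have [A [p [hp cA]]] := cofibrant_approximation (M i) (proj1_sig Z i).
have [_ wp] := hp; exists A, p; split=> //; split=> //.
by apply/(key _ _ s A p cA wp); apply: hs.
Qed.

End Sheaves.

(** Extend [e] to a fibrant approximation of [X]; it is then represented by a
    map out of [K], which is a weak equivalence by saturation. *)
Lemma fibrant_roof (C : Category) (M : ModelStructure C) (K X : C)
  (e : Hom (gamma M K) (gamma M X)) : bifibrant M K -> is_iso e ->
  exists (X' : C) (q : Hom X X') (f : Hom K X'), weq M q /\ weq M f.
Proof.
move=> [_ cK] ie; have [X' [q [[_ wq] fX']]] := fibrant_approximation M X.
have [f ef] := gamma_full (fmap (gamma M) q ∘ e) cK fX'.
exists X', q, f; split=> //; apply: weq_of_iso; rewrite ef.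
by apply: is_iso_comp => //; apply: gamma_weq_iso.
Qed.

Theorem theorem4p3p4
  (I : Category) (C : I -> Category)
  (M : forall i, ModelStructure (C i))
  (B : AdjunctionBundle C) (hB : model_bundle M B)
  (rep : forall i, Replacements (M i))
  (H : HomotopyBundle rep hB)
  (T : ModelStructure (Tw B))
  (hT : forall (Y Z : Tw B) (f : Hom Y Z), weq T f <-> pointwise_weq M f)
  (hbar : Functor (Ho T) (Tw H))
  (hhbar : hbar_case1 hbar \/ hbar_case2 hbar \/ hbar_case3 hT hbar) :
  (forall Y : Tw B,
     left_homotopy_sheaf M Y <-> left_strict_sheaf (hbar (gamma T Y)))
  /\
  (forall (Y Z : Tw B) (f : Hom Y Z), weq T f ->
     (left_homotopy_sheaf M Y <-> left_homotopy_sheaf M Z)).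
Proof.
have inv (Y Z : Tw B) (f : Hom Y Z) : weq T f ->
    left_homotopy_sheaf M Y <-> left_homotopy_sheaf M Z.
  by move=> /hT wf; apply: (left_homotopy_sheaf_weq hB wf).
split=> // Y.
case: hhbar => [[hfib e]|[[hpw [R e]]|[hpw [mu [[eta [_ ieta]] [_ ->]]]]]].
- have := functor_eq_ob e Y; rewrite /= => ->.
  by rewrite Gamma_left_strict_sheaf.
- have := functor_eq_ob e Y; rewrite /= => ->.
  rewrite Gamma_left_strict_sheaf; exact: inv (frf_weq R Y).
- have [X' [q [f [wq wf]]]] := @fibrant_roof _ T (proj1_sig (mu (gamma T Y))) Y
    (eta Y) (proj2_sig (mu (gamma T Y))) (ieta Y).
  rewrite (inv _ _ _ wq) -(inv _ _ _ wf).
  symmetry; apply: (Gamma_left_strict_sheaf H).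
Qed.
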